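(* There exists an algorithm that, given a word $w\in\Sigma^n$ (with $\Sigma=\{1,\dots,\sigma\}$) and $k\in\mathbb N$, computes the rollercoaster table $R_w^k$ in $O(n\sigma k)$ time.
   Context: Words are finite sequences over the ordered alphabet $\Sigma=\{1,\dots,\sigma\}$ (usual order), $\Sigma$ being the set of letters of the input word; $\mathrm{letters}(u)$ is the set of distinct letters of $u$. A subsequence of $w$ is $w[i_1]\cdots w[i_t]$ with $i_1<\dots<i_t$. A factor $u=w[i,j]$ is a plateau-run if it is weakly increasing (orientation $\uparrow$) or weakly decreasing (orientation $\downarrow$); an increasing plateau-run $w[i,j]$ is maximal if ($i=1$ or $w[i-1]>w[i]$) and ($j=|w|$ or $w[j]>w[j+1]$), symmetrically for decreasing ones. A plateau-run $u$ is a plateau-$k$-run if $|\mathrm{letters}(u)|\ge k$. For $\xi\in\{\uparrow,\downarrow\}$, $h\in[k]$, a word is a plateau-$(k,h)_\xi$-rollercoaster if, decomposing it into its maximal plateau-runs $r_1,\dots,r_x$ (consecutive runs alternate orientation and overlap in their common plateau), $r_x$ has orientation $\xi$, $r_1,\dots,r_{x-1}$ are plateau-$k$-runs and $r_x$ is a plateau-$h$-run (a plateau-$k$-run if $h=k$); a final letter/plateau may also count as a run of the opposite orientation (e.g. $43321$ is a plateau-$(3,3)_\downarrow$- and a plateau-$(3,1)_\uparrow$-rollercoaster). The rollercoaster table $R_w^k$ is the $n\times 2\times k$ table indexed by $i\in[1,n]$, $\xi\in\{\uparrow,\downarrow\}$, $h\in[1,k]$, where $R_w^k[i,\xi,h]$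 is the number of subsequences $s$ of $w$ which are plateau-$(k,h)_\xi$-rollercoasters ending at position $i$ of $w$ (i.e. $w[i]$ is the last symbol of $s$). Model: word RAM with logarithmic word size.
   Formalization: Table entries reach 2^(n-1), so the table cannot even be written in O(nσk) steps with logarithmic words; time is instead counted on a unit-cost RAM with unbounded cells, having only addition, subtraction, comparison and load/store. *)

(* Defs.v *)
From mathcomp Require Import all_boot.
From mathcomp Require Import boolp.
Set Implicit Arguments. Unset Strict Implicit. Unset Printing Implicit Defensive.

(* Words are seq nat; positions are 0-based (position i of the paper   *)
(* is index i-1 here).  Orientation: true = increasing (up),           *)
(* false = decreasing (down).                                          *)

Definition nletters (u : seq nat) : nat := size (undup u).

Definition factor (u : seq nat) (i j : nat) : seq nat := take (j.+1 - i) (drop i u).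

Definition plateau_run (up : bool) (u : seq nat) : bool :=
  if up then sorted leq u else sorted geq u.

Definition maximal_run (u : seq nat) (r : nat * nat * bool) : bool :=
  let: (i, j, up) := r in
  [&& i <= j, j < size u, plateau_run up (factor u i j),
      (i == 0) || (if up then nth 0 u i.-1 > nth 0 u i else nth 0 u i.-1 < nth 0 u i)
    & (j == (size u).-1) || (if up then nth 0 u j > nth 0 u j.+1 else nth 0 u j < nth 0 u j.+1)].

Definition r_start (r : nat * nat * bool) := r.1.1.
Definition r_end (r : nat * nat * bool) := r.1.2.
Definition r_up (r : nat * nat * bool) := r.2.

(* consecutive maximal runs alternate orientation and overlap in their
   common plateau (the last plateau of r is the first plateau of r') *)
Definition next_run (u : seq nat) (r r' : nat * nat * bool) : bool :=
  [&& r_up r' == ~~ r_up r,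
      r_start r < r_start r' <= r_end r, r_end r < r_end r'
    & constant (factor u (r_start r') (r_end r))].

Definition run_decomposition (u : seq nat) (rs : seq (nat * nat * bool)) : Prop :=
  exists r1 rs', rs = r1 :: rs' /\
    [/\ r_start r1 = 0, r_end (last r1 rs') = (size u).-1,
        all (maximal_run u) rs & path (next_run u) r1 rs'].

Definition run_letters (u : seq nat) (r : nat * nat * bool) : nat :=
  nletters (factor u (r_start r) (r_end r)).

(* u is a plateau-(k,h)_xi-rollercoaster.  Either the last run r_x has
   orientation xi, r_1..r_{x-1} are plateau-k-runs and r_x is a
   plateau-h-run; or (final plateau counted as an extra run of the
   opposite orientation) r_x has orientation ~~xi, r_1..r_x are all
   plateau-k-runs and the final plateau (which has exactly one distinct
   letter) is a plateau-h-run, i.e. h <= 1. *)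
Definition rollercoaster (k h : nat) (xi : bool) (u : seq nat) : Prop :=
  u <> [::] /\
  exists r1 rs, run_decomposition u (r1 :: rs) /\
   ((r_up (last r1 rs) = xi /\
     all (fun r => k <= run_letters u r) (belast r1 rs) /\
     h <= run_letters u (last r1 rs))
   \/
    (r_up (last r1 rs) = ~~ xi /\
     all (fun r => k <= run_letters u r) (r1 :: rs) /\
     h <= nletters [:: last 0 u])).

(* number of subsequences (choices of index sets, encoded as masks) of w
   which are plateau-(k,h)_xi-rollercoasters and whose last symbol is at
   (0-based) position i of w *)
Definition ends_at (n : nat) (m : n.-tuple bool) (i : nat) : bool :=
  nth false m i && [forall j : 'I_n, (i < j) ==> ~~ nth false m j].

Definition rtable (w : seq nat) (k i : nat) (xi : bool) (h : nat) : nat :=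
  #|[set m : (size w).-tuple bool |
      ends_at m i && `[< rollercoaster k h xi (mask m w) >]]|.

(* Machine model: a unit-cost RAM.  Memory is an infinite array of     *)
(* natural-number cells (nat -> nat); a program is a finite list of    *)
(* instructions; each executed instruction costs one time unit.        *)
(* Only addition, truncated subtraction, comparison, constants and     *)
(* direct/indirect memory access are available (no multiplication,     *)
(* division or shifts).                                                *)

Inductive instr : Type :=
  | IConst (dst c : nat)
  | IAdd   (dst a b : nat)
  | ISub   (dst a b : nat)
  | ILoad  (dst a : nat)
  | IStore (a src : nat)
  | IJlt   (a b l : nat)
  | IHalt.

Definition program := seq instr.

Record state := State { pc : nat; memory : nat -> nat }.

Definition upd (m : nat -> nat) (a v : nat) : nat -> nat :=
  fun x => if x == a then v else m x.

Definition halted (P : program) (s : state) : bool :=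
  if nth IHalt P (pc s) is IHalt then true else false.

Definition step (P : program) (s : state) : state :=
  let m := memory s in
  let p := pc s in
  match nth IHalt P p with
  | IConst d c => State p.+1 (upd m d c)
  | IAdd d a b => State p.+1 (upd m d (m a + m b))
  | ISub d a b => State p.+1 (upd m d (m a - m b))
  | ILoad d a => State p.+1 (upd m d (m (m a)))
  | IStore a src => State p.+1 (upd m (m a) (m src))
  | IJlt a b l => State (if m a < m b then l else p.+1) m
  | IHalt => s
  end.

Fixpoint exec (P : program) (t : nat) (s : state) : option state :=
  if halted P s then Some s else
  match t with
  | 0 => None
  | t'.+1 => exec P t' (step P s)
  end.

Definition init_state (w : seq nat) (sigma k : nat) : state :=
  State 0 (fun x =>
    if x == 0 then size w else if x == 1 then sigma else if x == 2 then k
    else if (3 <= x) && (x < 3 + size w) then nth 0 w (x - 3) else 0).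

(* Output encoding: entry R[i, xi, h] (0-based position i, h in [1,k])
   is stored in cell 3 + n + (2 i + [xi = down]) k + (h - 1). *)
Definition out_addr (n k i : nat) (xi : bool) (h : nat) : nat :=
  3 + n + ((2 * i + (~~ xi)) * k + h.-1).

(* Main.v *)
(** For each orientation xi, the largest level h <= k (0 if none) such that a
    word is a (k,h)_xi-rollercoaster evolves deterministically when a letter is
    appended: repeating the last letter changes nothing; moving in direction xi
    raises the level of xi by one, unless it is 0, and sets the level of the
    opposite orientation to 1 if that of xi becomes k, and to 0 otherwise.
    Hence the row of the table at position i is the sum, over j < i, of rows at
    j that are copied, shifted, or reduced to one entry according to the
    comparison of w[j] and w[i].  The machine keeps, for every letter y, the
    row that the next position would receive if it carried y: filling a row is
    a copy of 2k cells, after which its contribution is pushed to all sigma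
    letters, in time O(sigma k) per position. *)

Require Import Defs.
From mathcomp Require Import all_boot zify.
From mathcomp Require Import boolp.
Set Implicit Arguments. Unset Strict Implicit. Unset Printing Implicit Defensive.

(** * Runs of a word extended by one letter *)

(** A run that follows another one must overlap it and end strictly later, so the last run of a
    nonconstant word has at least two distinct letters. Level 1 after a turn is therefore never
    witnessed by a run of the decomposition; it comes from the clause that lets the final plateau
    count as an extra run. Constant words are the exception: their single run has both orientations.
    An entry counts the words of level at least [h], which is why the shift reads entry
    [max(1, h-1)]: a level 0 cannot be raised. Likewise a turn feeds entry 1 alone, from the words
    of level at least [max(1, k-1)], those that the new letter brings to level [k]. On the machine,
    the obstacle is space near address 0. The input starts at cell 3 and the table must start right
    behind it, so only cells 0 to 2 are free at the start, and for short inputs the table covers the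
    cells used as registers. The input is therefore partly moved away, the table is built at a
    higher address and copied down at the end. Without multiplication, products such as [2k * n] and
    [2k * x] are obtained by repeated addition. *)

Definition lex (xi : bool) (a b : nat) := if xi then a <= b else b <= a.
Definition ltx (xi : bool) (a b : nat) := if xi then a < b else b < a.

Notation run := (nat * nat * bool)%type.

Lemma size_factor u i j : j < size u -> size (factor u i j) = j.+1 - i.
Proof. by move=> lj; rewrite /factor size_take size_drop; case: ltnP; lia. Qed.

Lemma nth_factor u i j a : i + a <= j -> nth 0 (factor u i j) a = nth 0 u (i + a).
Proof. by move=> la; rewrite nth_take ?nth_drop //; lia. Qed.

Lemma factor_rcons u x i j : j < size u -> factor (rcons u x) i j = factor u i j.
Proof.
move=> lj; case: (leqP i j) => lij; last first.
  by rewrite /factor (_ : j.+1 - i = 0) ?take0 //; lia.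
apply: (@eq_from_nth _ 0); first by rewrite !size_factor ?size_rcons // ltnW.
rewrite size_factor ?size_rcons; last lia.
move=> a la; rewrite !nth_factor; try lia.
by rewrite nth_rcons (_ : i + a < size u) //; lia.
Qed.

Lemma factor_rcons_last u x i : i < size u ->
  factor (rcons u x) i (size u) = rcons (factor u i (size u).-1) x.
Proof.
move=> li; rewrite /factor drop_rcons ?(ltnW li) //.
rewrite take_oversize ?size_rcons ?size_drop; last lia.
by rewrite take_oversize // size_drop; lia.
Qed.

Lemma constant_factorP u i j : i <= j -> j < size u ->
  reflect (forall a, i <= a <= j -> nth 0 u a = nth 0 u i) (constant (factor u i j)).
Proof.
move=> lij lj; apply: (iffP idP).
  case/(constantP 0) => y; rewrite [size _](size_factor i lj) => E.
  have H a : i <= a <= j -> nth 0 u a = y.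
    case/andP=> ia aj; have := @nth_factor u i j (a - i).
    rewrite subnKC // => /(_ aj) <-.
    by rewrite E nth_nseq ifT //; lia.
  by move=> a la; rewrite !H // leqnn lij.
move=> H; apply/(constantP 0); exists (nth 0 u i).
rewrite [size _](size_factor i lj).
apply: (@eq_from_nth _ 0); rewrite ?size_nseq size_factor // => a la.
by rewrite nth_factor ?nth_nseq ?la ?H //; lia.
Qed.

Lemma plateau_runP u i j xi : j < size u ->
  reflect (forall a, i <= a -> a < j -> lex xi (nth 0 u a) (nth 0 u a.+1))
    (plateau_run xi (factor u i j)).
Proof.
move=> lj; have -> : plateau_run xi (factor u i j) = sorted (lex xi) (factor u i j).
  by case: xi.
apply: (iffP (sortedP 0)) => H a; rewrite ?size_factor // => la.
  move=> aj; have := H (a - i); rewrite size_factor // !nth_factor; try lia.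
  by rewrite addnS subnKC //; apply; lia.
by rewrite !nth_factor ?addnS; try lia; apply: H; lia.
Qed.

Lemma maximal_runP u i j xi :
  reflect [/\ i <= j, j < size u,
     forall a, i <= a -> a < j -> lex xi (nth 0 u a) (nth 0 u a.+1),
     i = 0 \/ ltx xi (nth 0 u i) (nth 0 u i.-1)
   & j = (size u).-1 \/ ltx xi (nth 0 u j.+1) (nth 0 u j)]
   (maximal_run u (i, j, xi)).
Proof.
rewrite /maximal_run; apply: (iffP and5P).
  case=> lij lj /(plateau_runP _ _ lj) H s e; split=> //.
    by case/orP: s => [/eqP|]; [left|right].
  by case/orP: e => [/eqP|]; [left|right].
case=> lij lj H s e; split=> //; first exact/plateau_runP.
  by apply/orP; case: s => [/eqP|]; [left|right].
by apply/orP; case: e => [/eqP|]; [left|right].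
Qed.

Lemma nletters_rcons_in f x : x \in f -> nletters (rcons f x) = nletters f.
Proof.
move=> xf; apply/perm_size/perm_undup => y.
by rewrite mem_rcons inE; case: eqP => // ->; rewrite xf.
Qed.

Lemma nletters_rcons_notin f x : x \notin f -> nletters (rcons f x) = (nletters f).+1.
Proof.
move=> xf; rewrite /nletters -[RHS]/((size (undup f)).+1).
rewrite (perm_size (s2 := undup (x :: f))); first by rewrite /= (negPf xf).
by apply: perm_undup => y; rewrite mem_rcons.
Qed.

Lemma nletters_constant f : f != [::] -> constant f -> nletters f = 1.
Proof.
case: f => // x s _ /= /all_pred1P ->.
apply: (perm_size (s2 := undup [:: x])); apply: perm_undup => y.
by rewrite !inE mem_nseq; case: eqP => //=; rewrite andbF.
Qed.

Definition chain (k : nat) (u : seq nat) (pre : seq run) (r : run) : Prop :=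
  [/\ r_start (head r pre) = 0, all (maximal_run u) (rcons pre r),
      sorted (next_run u) (rcons pre r) & all (fun r => k <= run_letters u r) pre].

(* A constant word satisfies this for both orientations. *)
Definition ends_run (k : nat) (u : seq nat) (xi : bool) (c : nat) : Prop :=
  exists pre i, chain k u pre (i, (size u).-1, xi) /\
    run_letters u (i, (size u).-1, xi) = c.

(** The final plateau has exactly one distinct letter, so counting it as an extra run of orientation
    [xi] amounts to [h <= 1]. Both alternatives then depend only on the last run and its number of
    letters. *)
Lemma rollercoaster_ends_run k h xi u : u <> [::] ->
  rollercoaster k h xi u <->
  exists c, (ends_run k u xi c /\ h <= c) \/
            [/\ ends_run k u (~~ xi) c, k <= c & h <= 1].
Proof.
move=> u0; rewrite /rollercoaster; split.
  case=> _ [r1 [rs [[r1' [rs' [[<- <-] [st en mx ne]]]]]]].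
  case/lastP: rs st en mx ne => [|rs r] st en mx ne.
    case: r1 st en mx ne => -[i j] up /= st en mx ne.
    case=> [[E [_ hc]]|[E [hk hc]]]; exists (run_letters u (i, j, up)).
      left; split=> //; exists [::], i; rewrite -en -E; split=> //.
    right; split=> //; last by rewrite andbT in hk.
    by exists [::], i; rewrite -en -E; split.
  rewrite last_rcons belast_rcons in en *.
  case: r en mx ne => -[i j] up /= en mx ne.
  have C : all (fun r => k <= run_letters u r) (r1 :: rs) ->
     chain k u (r1 :: rs) (i, j, up) by move=> H; split.
  case=> [[E [hk hc]]|[E [hk hc]]]; exists (run_letters u (i, j, up)).
    by left; split=> //; exists (r1 :: rs), i; rewrite -en -E; split=> //; apply: C.
  move: hk; rewrite all_rcons andbCA => /andP[hk H].
  right; split=> //.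
  by exists (r1 :: rs), i; rewrite -en -E; split=> //; apply: C.
move=> H; split=> //.
have {H} : exists xi' pre i, let r := (i, (size u).-1, xi') in chain k u pre r /\
    (xi' = xi /\ h <= run_letters u r \/
     [/\ xi' = ~~ xi, k <= run_letters u r & h <= 1]).
  case: H => c [[[pre [i [C E]]] hc]|[[pre [i [C E]]] kc h1]].
    by exists xi, pre, i; split=> //; left; rewrite E.
  by exists (~~ xi), pre, i; split=> //; right; rewrite E.
case=> xi' [pre [i]]; set r := (i, _, _) => -[[st mx ne ks] H].
case: pre st mx ne ks => [|r1 pre] /= st mx ne ks.
  exists r, [::]; split; first by exists r, [::]; split.
  by case: H => [[? ?]|[? kc ?]]; [left|right]; rewrite /= ?kc.
exists r1, (rcons pre r); split.
  by exists r1, (rcons pre r); split=> //; rewrite last_rcons.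
rewrite last_rcons belast_rcons /= all_rcons.
by case: H => [[? ?]|[? kc ?]]; [left|right]; rewrite ?kc.
Qed.

(** Maximality looks one letter past the end of a run, and here that letter already belongs to
    [u]. *)
Lemma maximal_run_rcons u x r : r_end r < (size u).-1 ->
  maximal_run (rcons u x) r = maximal_run u r.
Proof.
case: r => -[i j] xi; rewrite /r_end /= => lj.
case: (leqP i j) => //= lij.
rewrite size_rcons factor_rcons; last lia.
rewrite (_ : (j < (size u).+1) = (j < size u)); last lia.
rewrite (_ : (j == _) = (j == (size u).-1)); last lia.
rewrite !nth_rcons.
rewrite (_ : (i.-1 < size u) = true); last lia.
rewrite (_ : (i < size u) = true); last lia.
rewrite (_ : (j < size u) = true); last lia.
by rewrite (_ : (j.+1 < size u) = true); last lia.
Qed.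

(** A [chain] is split into its earlier runs, their junction with the last run ([link]), and the
    last run, because an appended letter affects these three in different ways. *)
Definition runs_ok (k : nat) (u : seq nat) (pre : seq run) : bool :=
  [&& all (maximal_run u) pre, sorted (next_run u) pre
    & all (fun r => k <= run_letters u r) pre].

Definition link (u : seq nat) (pre : seq run) (r : run) : bool :=
  if pre is r1 :: pre' then (r_start r1 == 0) && next_run u (last r1 pre') r
  else r_start r == 0.

Lemma chainE k u pre r :
  chain k u pre r <-> [/\ runs_ok k u pre, link u pre r & maximal_run u r].
Proof.
rewrite /chain /runs_ok; case: pre => [|r1 pre] /=.
  rewrite andbT; split; first by case=> -> ->.
  by case=> _ /eqP -> ->.
rewrite rcons_path all_rcons; split.
  by case=> -> /and3P[-> -> ->] /andP[-> ->] /= ->.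
by case=> /and3P[/andP[-> ->] -> ->] /andP[/eqP -> ->] ->.
Qed.

Lemma chain_lt k u pre r : chain k u pre r ->
  all (fun r' => r_end r' < r_end r) pre.
Proof.
case=> _ _ H _.
have: sorted (fun r r' => r_end r < r_end r') (rcons pre r).
  by apply: sub_sorted H => a b /and4P[].
rewrite sorted_pairwise; last by move=> a b c; apply: ltn_trans.
by rewrite pairwise_rcons => /andP[].
Qed.

Lemma chain_rcons k u pre r r' : chain k u (rcons pre r) r' ->
  [/\ chain k u pre r, k <= run_letters u r & next_run u r r'].
Proof.
case=> st mx ne; rewrite all_rcons => /andP[-> ks].
move: mx ne; rewrite all_rcons => /andP[_ mx].
case: pre st mx ks => [|r1 pre] /= st mx ks.
  by rewrite andbT => ->.
rewrite rcons_path last_rcons => /andP[ne ->]; split=> //.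
Qed.

Lemma runs_ok_rcons k u x pre :
  all (fun r => r_end r < (size u).-1) pre ->
  runs_ok k (rcons u x) pre = runs_ok k u pre.
Proof.
move=> lt; rewrite /runs_ok; congr [&& _, _ & _].
- by apply: eq_in_all => r /(allP lt) /maximal_run_rcons.
- apply: (eq_in_sorted (P := fun r => r_end r < (size u).-1)) => // r r' lr _.
  by rewrite /next_run factor_rcons //; move: lr; rewrite unfold_in; lia.
apply: eq_in_all => r /(allP lt) lr.
by rewrite /run_letters factor_rcons //; lia.
Qed.

Lemma link_rcons u x pre i xi :
  all (fun r => r_end r < (size u).-1) pre ->
  link (rcons u x) pre (i, size u, xi) = link u pre (i, (size u).-1, xi).
Proof.
case: pre => [|r1 pre] // lt; rewrite /link; congr (_ && _).
have lr : r_end (last r1 pre) < (size u).-1 by apply: (allP lt _ (mem_last r1 pre)).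
by rewrite /next_run factor_rcons /r_end /r_start /r_up /= -/(r_end _) ?lr; lia.
Qed.

Lemma maximal_run_ext u x i xi : i < size u ->
  lex xi (nth 0 u (size u).-1) x ->
  maximal_run (rcons u x) (i, size u, xi) = maximal_run u (i, (size u).-1, xi).
Proof.
move=> li le; apply/maximal_runP/maximal_runP.
  case=> _ _ H s _; split=> //; try lia.
  - move=> a ia aj; have := H a ia.
    rewrite !nth_rcons (_ : a < size u); last lia.
    by rewrite (_ : a.+1 < size u); [apply; lia|lia].
  - move: s; rewrite !nth_rcons li (_ : i.-1 < size u) //; lia.
case=> _ _ H s _; split; rewrite ?size_rcons //; try lia.
- move=> a ia aj; rewrite !nth_rcons (_ : a < size u); last lia.
  case: (ltngtP a.+1 (size u)) => [lt|gt|E]; [by apply: H; lia|lia|].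
  by rewrite (_ : a = (size u).-1) //; lia.
- by move: s; rewrite !nth_rcons li (_ : i.-1 < size u) //; lia.
Qed.

Lemma chain_ext k u x pre i xi : i < size u ->
  lex xi (nth 0 u (size u).-1) x ->
  all (fun r => r_end r < (size u).-1) pre ->
  chain k (rcons u x) pre (i, size u, xi) <-> chain k u pre (i, (size u).-1, xi).
Proof.
move=> li le lt.
by rewrite !chainE runs_ok_rcons // link_rcons // maximal_run_ext.
Qed.

(** A run consisting of [x] alone could be extended to the left, since the step to [x] already
    agrees with [xi]. *)
Lemma chain_start k u x pre i xi : 0 < size u ->
  lex xi (nth 0 u (size u).-1) x ->
  chain k (rcons u x) pre (i, size u, xi) -> i < size u.
Proof.
move=> u0 le /chainE[_ _ /maximal_runP[lij _ _ s _]].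
case: s => [->//|]; move: lij; rewrite leq_eqVlt => /orP[/eqP->|//].
by rewrite !nth_rcons ltnn eqxx prednK // leqnn; case: xi le => /=; lia.
Qed.

Lemma run_letters_in u y i xi : i < size u -> y = nth 0 u (size u).-1 ->
  run_letters (rcons u y) (i, size u, xi) = run_letters u (i, (size u).-1, xi).
Proof.
move=> li ->; rewrite /run_letters /r_start /r_end /= factor_rcons_last //.
apply: nletters_rcons_in.
have -> : nth 0 u (size u).-1 = nth 0 (factor u i (size u).-1) ((size u).-1 - i).
  by rewrite nth_factor subnKC //; lia.
by rewrite mem_nth // size_factor; lia.
Qed.

(** By monotonicity the last letter of the run is extremal in direction [up], so a letter strictly
    beyond it is new. *)
Lemma run_letters_notin u x i xi up : i < size u ->
  maximal_run u (i, (size u).-1, up) -> ltx up (nth 0 u (size u).-1) x ->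
  run_letters (rcons u x) (i, size u, xi) = (run_letters u (i, (size u).-1, xi)).+1.
Proof.
move=> li /maximal_runP[_ lj H _ _] lt.
rewrite /run_letters /r_start /r_end /= factor_rcons_last //.
apply: nletters_rcons_notin; apply/negP => /(nthP 0)[a].
rewrite size_factor // => la; rewrite nth_factor; last lia.
move=> E.
have mono d : d <= (size u).-1 - i ->
    lex up (nth 0 u ((size u).-1 - d)) (nth 0 u (size u).-1).
  elim: d => [_|d IH ld]; first by rewrite subn0; case: (up) => /=.
  have := H ((size u).-1 - d.+1); rewrite subnSK; last lia.
  have := IH (ltnW ld); case: (up) => /= h1 /(_ ltac:(lia) ltac:(lia)); lia.
have := mono ((size u).-1 - (i + a)); rewrite subKn; last lia.
by move=> /(_ ltac:(lia)); rewrite E; case: (up) lt => /=; lia.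
Qed.

Lemma ends_run_plateau k u y xi c : 0 < size u -> y = nth 0 u (size u).-1 ->
  ends_run k (rcons u y) xi c <-> ends_run k u xi c.
Proof.
move=> u0 E; have le up : lex up (nth 0 u (size u).-1) y.
  by rewrite E; case: up => /=.
rewrite /ends_run size_rcons; split=> -[pre [i [C L]]]; exists pre, i.
  have li := chain_start u0 (le xi) C.
  suff lt : all (fun r => r_end r < (size u).-1) pre.
    by rewrite -(@chain_ext k u y) // -(run_letters_in _ li E).
  (* An earlier run ending at the last position of [u] would not be maximal on the right: the letter
     after it is equal. *)
  apply/allP => r rin; have /allP/(_ r rin) := chain_lt C.
  rewrite /r_end /= leq_eqVlt -/(r_end r) => /orP[/eqP Er|]; last lia.
  have /allP/(_ r) : all (maximal_run (rcons u y)) (rcons pre (i, size u, xi)) by case: C.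
  rewrite mem_rcons inE rin orbT => /(_ isT).
  case: r Er {rin} => -[i' j'] up /= Er /maximal_runP[_ _ _ _].
  rewrite size_rcons !nth_rcons /r_end /= in Er *.
  rewrite (_ : j' < size u) // (_ : j' = (size u).-1) ?prednK ?ltnn ?eqxx -?E; try lia.
  by case: (up) => /=; lia.
have li : i < size u by case/chainE: C => _ _ /maximal_runP[]; lia.
rewrite chain_ext ?run_letters_in //; exact: chain_lt C.
Qed.

(** A last run of orientation [~~ xi] would consist of [x] alone, and would then start after the end
    of the preceding run instead of overlapping it. *)
Lemma ends_run_turn k u x xi c : 0 < size u ->
  ltx xi (nth 0 u (size u).-1) x -> ~ ends_run k (rcons u x) (~~ xi) c.
Proof.
move=> u0 lt; rewrite /ends_run size_rcons => -[pre [i [/= C _]]].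
have iE : i = size u.
  case/chainE: (C) => _ _ /maximal_runP[le _ H _ _].
  move: le; rewrite leq_eqVlt => /orP[/eqP //|li].
  have := H (size u).-1; rewrite prednK // leqnn => /(_ ltac:(lia) isT).
  by rewrite !nth_rcons ltnn eqxx prednK // leqnn; case: xi lt {C H} => /=; lia.
move: C; rewrite iE {iE}; case/lastP: pre => [|pre r].
  by case=> /=; rewrite /r_start /=; lia.
move=> C; have := chain_lt C; rewrite all_rcons => /andP[lr _].
case/chain_rcons: C => _ _ /and4P[_ /andP[_ ge] _ _].
by move: ge lr; rewrite /r_start /r_end /=; lia.
Qed.

(** The start [s] of the final plateau is where the next run begins if the word turns. *)
Lemma last_plateau u i : i < size u ->
  ~~ constant (factor u i (size u).-1) ->
  exists s, [/\ i < s, s < size u, constant (factor u s (size u).-1)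
    & nth 0 u s.-1 <> nth 0 u s].
Proof.
move=> li nc.
pose P s := (s < size u) && constant (factor u s (size u).-1).
have exP : exists s, P s.
  exists (size u).-1; rewrite /P prednK ?leqnn /=; last lia.
  apply/constant_factorP => //; try lia.
  by move=> a /anti_leq ->.
case: (ex_minnP exP) => s /andP[ls cs] mins; exists s.
have si : i < s.
  rewrite ltnNge; apply: contra nc => si.
  move/constant_factorP: cs => cs; apply/constant_factorP; try lia.
  by move=> a la; rewrite !cs //; lia.
split=> // E; have := mins s.-1; case: s => // s in si ls cs E mins *.
rewrite /= ltnn => F; suff: s.+1 <= s by rewrite ltnn.
apply: mins; rewrite /P ltnW //=; apply/constant_factorP; try lia.
move=> a /andP[]; rewrite leq_eqVlt => /orP[/eqP->//|sa aj].
by move/constant_factorP: cs => -> //; lia.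
Qed.

Lemma link_rcons_same u x pre r : all (fun r => r_end r < size u) pre ->
  link (rcons u x) pre r = link u pre r.
Proof.
case: pre => [|r1 pre] // lt; rewrite /link; congr (_ && _).
by rewrite /next_run factor_rcons // (allP lt _ (mem_last r1 pre)).
Qed.

(** At the end of [u] the run is maximal because the word stops there; in [rcons u x], because [x]
    moves strictly against it. *)
Lemma maximal_run_turn u x i xi : i < size u ->
  ltx xi (nth 0 u (size u).-1) x ->
  maximal_run (rcons u x) (i, (size u).-1, ~~ xi) =
  maximal_run u (i, (size u).-1, ~~ xi).
Proof.
move=> li lt; have u0 : 0 < size u by case: (size u) li.
have si : i.-1 < size u by rewrite (leq_ltn_trans (leq_pred i)).
have lt1 a : a < (size u).-1 -> a.+1 < size u by rewrite -ltnS prednK.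
have lt0 a (H : a < (size u).-1) := ltnW (lt1 a H).
apply/maximal_runP/maximal_runP.
  case=> m1 _ m3 m4 _; split=> //; [by rewrite prednK| |by rewrite !nth_rcons li si in m4|by left].
  by move=> a ia aj; have := m3 a ia aj; rewrite !nth_rcons (lt1 a aj) (lt0 a aj).
case=> m1 m2 m3 m4 _; split=> //.
- by rewrite size_rcons ltnW.
- by move=> a ia aj; rewrite !nth_rcons (lt1 a aj) (lt0 a aj); apply: m3.
- by rewrite !nth_rcons li si.
right; rewrite !nth_rcons prednK // ltnn eqxx leqnn.
by case: (xi) lt.
Qed.

(** Either the last run of [u] grows by the new letter [x], or [u] ends with a [k]-run of the
    opposite orientation and a new run starts, whose two letters are that of the final plateau of
    [u] and [x]. *)
Lemma ends_run_step k u x xi c : 0 < size u ->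
  ltx xi (nth 0 u (size u).-1) x ->
  ends_run k (rcons u x) xi c <->
  (exists c0, c = c0.+1 /\ ends_run k u xi c0) \/
  (c = 2 /\ exists c0, k <= c0 /\ ends_run k u (~~ xi) c0).
Proof.
move=> u0 lt; have le : lex xi (nth 0 u (size u).-1) x by case: xi lt => /= /ltnW.
have ext pre i : i < size u -> all (fun r => r_end r < (size u).-1) pre ->
    chain k u pre (i, (size u).-1, xi) ->
    ends_run k (rcons u x) xi (run_letters u (i, (size u).-1, xi)).+1.
  move=> li lp C; exists pre, i; rewrite size_rcons chain_ext //; split=> //.
  by apply: (run_letters_notin xi li _ lt); case/chainE: C.
split; last first.
  case=> [[c0 [-> [pre [i [C <-]]]]]|[-> [c0 [kc [pre [i [C E]]]]]]].
    apply: (ext _ _ _ (chain_lt C) C).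
    by case/chainE: C => _ _ /maximal_runP[]; lia.
  have [li mono] : i < size u /\ forall a, i <= a -> a < (size u).-1 ->
      lex (~~ xi) (nth 0 u a) (nth 0 u a.+1).
    by case/chainE: C => _ _ /maximal_runP[? ? ? ? ?]; split=> //; lia.
  (* If the last run is constant, a preceding run would end inside it, where no strict change makes
     it maximal. Hence the whole word is constant, and its only run can be reread with orientation
     [xi]. *)
  have [cst|] := boolP (constant (factor u i (size u).-1)).
    have cP a : i <= a <= (size u).-1 -> nth 0 u a = nth 0 u i.
      by move/constant_factorP: cst => cst; apply: cst; lia.
    have i0 : i = 0.
      case/lastP: pre C => [[]//|pre [[i' j'] up]] C.
      have := chain_lt C; rewrite all_rcons => /andP[lj _].
      case/chain_rcons: C => C _ /and4P[/eqP /= E' /andP[_ ij] _ _].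
      rewrite /r_start /r_end /r_up /= in lj ij E'.
      case/chainE: C => _ _ /maximal_runP[_ _ _ _ []]; first lia.
      by rewrite (cP j') ?(cP j'.+1); [case: (up) => /=; lia|lia|lia].
    have := @ext [::] 0 u0 isT; rewrite {1}/run_letters /r_start /r_end /=.
    rewrite i0 in cst cP *.
    rewrite (nletters_constant _ cst); last by rewrite -size_eq0 size_factor; lia.
    apply; apply/chainE; split=> //.
    apply/maximal_runP; split=> //; try lia.
    by move=> a ia aj; rewrite (cP a) ?(cP a.+1); [case: (xi) => /=|lia|lia].
  (* Otherwise the old last run becomes an inner run, and the new run overlaps it in the final
     plateau, which starts at [s]. *)
  case/(last_plateau li) => s [si ls cs ns].
  exists (rcons pre (i, (size u).-1, ~~ xi)), s.
  have cP a : s <= a <= (size u).-1 -> nth 0 u a = nth 0 u s.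
    by move/constant_factorP: cs => cs'; apply: cs'; lia.
  have mx : maximal_run u (s, (size u).-1, xi).
    apply/maximal_runP; split; try lia.
      by move=> a ia aj; rewrite (cP a) ?(cP a.+1); [case: (xi) => /=|lia|lia].
    have := mono s.-1; rewrite prednK; last lia.
    move=> /(_ ltac:(lia) ltac:(lia)) m; right.
    by case: (xi) m => /=; lia.
  rewrite size_rcons; split; last first.
    rewrite (run_letters_notin xi ls mx lt) /run_letters /r_start /r_end /=.
    by rewrite nletters_constant // -size_eq0 size_factor; lia.
  have lp := chain_lt C; case/chainE: C => ok lk mi.
  have mi' : maximal_run (rcons u x) (i, (size u).-1, ~~ xi).
    by rewrite maximal_run_turn.
  have lnk : next_run (rcons u x) (i, (size u).-1, ~~ xi) (s, size u, xi).
    rewrite /next_run /r_up /r_start /r_end /= negbK eqxx si factor_rcons ?prednK //.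
    by rewrite cs leqnn andbT /=; clear - ls u0; lia.
  have lk' : link (rcons u x) pre (i, (size u).-1, ~~ xi).
    rewrite link_rcons_same //; apply: sub_all lp => r lr.
    by rewrite (leq_trans lr) // leq_pred.
  have mx' : maximal_run (rcons u x) (s, size u, xi) by rewrite maximal_run_ext.
  move: ok; rewrite -(@runs_ok_rcons _ _ x) // => ok.
  have hk : k <= run_letters (rcons u x) (i, (size u).-1, ~~ xi).
    by rewrite /run_letters factor_rcons /r_end /= ?prednK // -/(run_letters u (i, (size u).-1, ~~ xi)) E.
  have [st al so kk] : chain k (rcons u x) pre (i, (size u).-1, ~~ xi) by apply/chainE.
  split.
  - by case: (pre) st.
  - by rewrite all_rcons mx'.
  - case: (pre) so => [|r1 p] /=; first by rewrite lnk.
    by rewrite !rcons_path !last_rcons lnk => /andP[-> ->].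
  by rewrite all_rcons hk.
rewrite /ends_run size_rcons => -[pre [i [/= C E]]].
have li := chain_start u0 le C.
have mx : maximal_run u (i, (size u).-1, xi).
  by rewrite -(@maximal_run_ext u x) //; case/chainE: C.
(* Either all earlier runs end before the last position of [u], and the last run extends one of [u],
   or the preceding run ends exactly there, and the word has just turned. *)
have [lp|] := boolP (all (fun r => r_end r < (size u).-1) pre).
  left; rewrite chain_ext // in C; exists (run_letters u (i, (size u).-1, xi)).
  split; last by exists pre, i.
  by rewrite -E; apply: run_letters_notin li mx lt.
case/lastP: pre C => // pre [[i' j'] up] C nlp; right.
have := chain_lt C; rewrite all_rcons => /andP[lj lp].
case/chain_rcons: C => C hk /and4P[/eqP /= E' /andP[i'i ij] _ cst].
have lp' := chain_lt C.
rewrite /r_start /r_end /r_up /= in lj ij E' i'i cst lp'.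
have jE : j' = (size u).-1.
  apply/eqP; rewrite eqn_leq; apply/andP; split; first by rewrite -ltnS prednK.
  rewrite leqNgt; apply: contra nlp => lj'; rewrite all_rcons lj' /=.
  by apply: sub_all lp' => r; rewrite /r_end /=; lia.
have {}E' : up = ~~ xi by rewrite E' negbK.
move: C hk cst lp'; rewrite {j' lj ij nlp}jE {up}E' factor_rcons ?prednK // => C hk cst lp'.
split.
  rewrite -E (run_letters_notin xi li mx lt) /run_letters /r_start /r_end /=.
  by rewrite nletters_constant // -size_eq0 size_factor; lia.
rewrite /run_letters factor_rcons /r_end /= ?prednK // in hk.
exists (run_letters u (i', (size u).-1, ~~ xi)); split=> //.
exists pre, i'; split=> //.
case/chainE: C => ok lk mi; apply/chainE; split.
- by rewrite -(@runs_ok_rcons _ _ x).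
- by rewrite -(@link_rcons_same u x).
by rewrite -(@maximal_run_turn u x) // (ltn_trans i'i).
Qed.

(** * Evolution of the rollercoaster level under an appended letter *)

Lemma ends_run_gt0 k u xi c : ends_run k u xi c -> 0 < c.
Proof.
case=> pre [i [/chainE[_ _ /maximal_runP[le lt _ _ _]] <-]].
rewrite /run_letters /nletters -has_predT.
have: nth 0 (factor u i (size u).-1) 0 \in undup (factor u i (size u).-1).
  by rewrite mem_undup mem_nth // size_factor // subn_gt0 ltnS.
by move=> H; apply/hasP; exists (nth 0 (factor u i (size u).-1) 0).
Qed.

Lemma ends_run1 k x xi c : ends_run k [:: x] xi c <-> c = 1.
Proof.
split=> [[pre [i [C <-]]]|->].
  by case/chainE: C => _ _ /maximal_runP[/=]; rewrite leqn0 => /eqP ->.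
exists [::], 0; split=> //; apply/chainE; split=> //.
by apply/maximal_runP; split=> //; left.
Qed.

Lemma rollercoaster1 k h xi x : 0 < h ->
  rollercoaster k h xi [:: x] <-> h = 1.
Proof.
move=> h0; rewrite rollercoaster_ends_run //; split=> [[c H]|->].
  suff h1 : h <= 1 by apply/eqP; rewrite eqn_leq h1.
  by case: H => [[/ends_run1 ->]|[]].
by exists 1; left; split=> //; apply/ends_run1.
Qed.

Lemma rollercoaster_plateau k h xi u y : u <> [::] ->
  y = nth 0 u (size u).-1 ->
  rollercoaster k h xi (rcons u y) <-> rollercoaster k h xi u.
Proof.
move=> u0 yE; have su : 0 < size u by case: (u) u0.
have E xi' c := ends_run_plateau k xi' c su yE.
rewrite !rollercoaster_ends_run //; last by case: (u).
split=> -[c [[/E H hc]|[/E H kc hc]]]; exists c; [left|right|left|right] => //;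
by split=> //; apply/E.
Qed.

(** If [u] has level 1 for [xi] only through its final plateau, the new run has two letters; so this
    case obeys the same rule as a run that grows by one letter. *)
Lemma rollercoaster_forward k h xi u x : u <> [::] -> 0 < h ->
  ltx xi (nth 0 u (size u).-1) x ->
  rollercoaster k h xi (rcons u x) <-> rollercoaster k (maxn 1 h.-1) xi u.
Proof.
move=> u0 h0 lt; have su : 0 < size u by case: (u) u0.
rewrite !rollercoaster_ends_run //; last by case: (u).
split=> -[c].
  case=> [[/ends_run_step]|[/ends_run_turn]]; last by move=> /(_ su lt).
  case/(_ su lt) => [[c0 [-> H]]|[-> [c0 [kc H]]]] hc; exists c0; [left|right].
    by split=> //; have := ends_run_gt0 H; clear - hc; lia.
  by split=> //; clear - hc; lia.
case=> [[H hc]|[H kc hc]].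
  exists c.+1; left; split; last by clear - hc; lia.
  by apply/ends_run_step => //; left; exists c.
exists 2; left; split; last by clear - hc; lia.
by apply/ends_run_step => //; right; split=> //; exists c.
Qed.

(** By [ends_run_turn] only the clause on the final plateau remains, which asks that [rcons u x] be
    of level [k] for [xi]; [rollercoaster_forward] with [h := k] moves this back to [u]. *)
Lemma rollercoaster_turn k h xi u x : u <> [::] -> 0 < k -> 0 < h ->
  ltx xi (nth 0 u (size u).-1) x ->
  rollercoaster k h (~~ xi) (rcons u x) <->
  h = 1 /\ rollercoaster k (maxn 1 k.-1) xi u.
Proof.
move=> u0 k0 h0 lt; have su : 0 < size u by case: (u) u0.
have ux : rcons u x <> [::] by case: (u).
rewrite -(rollercoaster_forward _ u0 k0 lt) !rollercoaster_ends_run // negbK.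
have no := ends_run_turn su lt.
split=> [[c [[/no//]|[H kc h1]]]|[-> [c [[H kc]|[/no//]]]]].
  by split; [apply/eqP; rewrite eqn_leq h1|exists c; left].
by exists c; right.
Qed.

(** * Counting subsequences *)

Lemma sum_tuple_rcons n (F : seq bool -> nat) :
  \sum_(t : n.+1.-tuple bool) F t =
  \sum_(t : n.-tuple bool) F (rcons t false) + \sum_(t : n.-tuple bool) F (rcons t true).
Proof.
have sz (t : n.+1.-tuple bool) : size (belast (thead t) (behead t)) == n.
  by rewrite size_belast size_behead size_tuple.
pose f (p : bool * n.-tuple bool) : n.+1.-tuple bool := [tuple of rcons p.2 p.1].
pose g (t : n.+1.-tuple bool) := (last (thead t) (behead t), Tuple (sz t)).
have eta (t : n.+1.-tuple bool) :
    rcons (belast (thead t) (behead t)) (last (thead t) (behead t)) = t.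
  by rewrite -lastI {3}[t]tuple_eta.
rewrite (reindex f) /=; last first.
  exists g => [[b t] _|t _]; last exact/val_inj/eta.
  have /rcons_inj[bE lE] := eta (f (b, t)).
  by rewrite /g lE; congr pair; apply: val_inj.
rewrite -(pair_big predT predT (fun b (t : n.-tuple bool) => F (rcons t b))) /=.
by rewrite big_bool addnC.
Qed.

(** Subsequences of a prefix are sorted by the position [j] of their last letter, the empty one
    being apart. *)
Lemma sum_mask (F : seq nat -> nat) w i : i <= size w ->
  \sum_(t : i.-tuple bool) F (mask t (take i w)) =
  F [::] + \sum_(j < i) \sum_(t : j.-tuple bool)
             F (rcons (mask t (take j w)) (nth 0 w j)).
Proof.
elim: i => [_|i IH li].
  rewrite big_ord0 addn0 (eq_bigr (fun=> F [::])) => [|t _]; last by rewrite tuple0 take0.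
  by rewrite sum_nat_const card_tuple expn0 mul1n.
rewrite big_ord_recr /= addnA -IH ?(ltnW li) //.
rewrite (sum_tuple_rcons i (fun t => F (mask t (take i.+1 w)))).
have E (t : i.-tuple bool) b : mask (rcons t b) (take i.+1 w) =
    mask t (take i w) ++ nseq b (nth 0 w i).
  by rewrite (take_nth 0) // mask_rcons // size_tuple size_takel // ltnW.
by congr (_ + _); apply: eq_bigr => t _; rewrite E ?cats0 ?cats1.
Qed.

(** A mask ending at [i] is an arbitrary mask of length [i], then [true], then only [false]. *)
Lemma rtableE w k i xi h : i < size w ->
  rtable w k i xi h = \sum_(t : i.-tuple bool)
    `[< rollercoaster k h xi (rcons (mask t (take i w)) (nth 0 w i)) >].
Proof.
move=> li; rewrite /rtable cardsE -sum1_card big_mkcond /=.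
pose z : seq bool := true :: nseq (size w - i.+1) false.
have sf (t : i.-tuple bool) : size (t ++ z) == size w.
  by rewrite size_cat /= size_nseq size_tuple addnS -addSn subnKC.
have sg (m : (size w).-tuple bool) : size (take i m) == i.
  by rewrite size_takel // size_tuple ltnW.
pose f t := Tuple (sf t); pose g m := Tuple (sg m).
have endsP (m : (size w).-tuple bool) : ends_at m i = (f (g m) == m).
  apply/idP/eqP => [/andP[mi /forallP H]|<-].
    apply: val_inj; apply: (@eq_from_nth _ false) => [|j].
      by rewrite (eqP (sf _)) size_tuple.
    rewrite (eqP (sf _)) => lj; rewrite nth_cat size_takel ?size_tuple ?(ltnW li) //.
    case: ltngtP => [ji|ij|->]; first by rewrite nth_take.
      rewrite -(subnSK ij) /= nth_nseq if_same.
      by have /= := H (Ordinal lj); rewrite ij /= => /negPf.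
    by rewrite subnn.
  rewrite /ends_at /= nth_cat (eqP (sg m)) ltnn subnn /=.
  apply/forallP => j; apply/implyP => ij; rewrite nth_cat (eqP (sg m)).
  by rewrite ltnNge ltnW //= -(subnSK ij) /= nth_nseq if_same.
transitivity (\sum_(m : (size w).-tuple bool | f (g m) == m)
    (`[< rollercoaster k h xi (mask m w) >] : nat)).
  rewrite [RHS]big_mkcond; apply: eq_bigr => m _; rewrite -endsP unfold_in.
  by case: ends_at => //=; case: `[< _ >].
rewrite (reindex_onto f g) /=; last by move=> m /eqP.
apply: eq_big => [t|t _].
  have -> : g (f t) = t.
    by apply: val_inj; rewrite /= take_size_cat // size_tuple.
  by rewrite !eqxx.
rewrite -{1}(cat_take_drop i w) mask_cat; last by rewrite size_tuple size_takel // ltnW.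
by rewrite (drop_nth 0) //= mask_false cats1.
Qed.

(** The index [j] is the position of the letter before the last one; the term [h == 1] counts the
    one-letter subsequence. *)
Lemma rtable_rec w k i xi h : i < size w -> 0 < k -> 0 < h ->
  rtable w k i xi h = (h == 1) + \sum_(j < i)
    (if nth 0 w j == nth 0 w i then rtable w k j xi h
     else if ltx xi (nth 0 w j) (nth 0 w i) then rtable w k j xi (maxn 1 h.-1)
     else (h == 1) * rtable w k j (~~ xi) (maxn 1 k.-1)).
Proof.
move=> li k0 h0; rewrite rtableE //.
rewrite (sum_mask (fun u => `[< rollercoaster k h xi (rcons u (nth 0 w i)) >])) ?(ltnW li) //.
congr (_ + _).
  by congr nat_of_bool; apply/asboolP/eqP => /rollercoaster1; apply.
apply: eq_bigr => j _; have lj := ltn_trans (ltn_ord j) li.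
have ne (t : j.-tuple bool) : rcons (mask t (take j w)) (nth 0 w j) <> [::].
  by case: mask.
have la (t : j.-tuple bool) : nth 0 w j =
    nth 0 (rcons (mask t (take j w)) (nth 0 w j))
      (size (rcons (mask t (take j w)) (nth 0 w j))).-1.
  by rewrite nth_last last_rcons.
case: eqP => [E|nE].
  rewrite rtableE //; apply: eq_bigr => t _; congr nat_of_bool; apply: asbool_equiv_eq.
  by apply: rollercoaster_plateau => //; rewrite -E -la.
case: ifP => lt.
  rewrite rtableE //; apply: eq_bigr => t _; congr nat_of_bool; apply: asbool_equiv_eq.
  by apply: rollercoaster_forward => //; rewrite -la.
have gt : ltx (~~ xi) (nth 0 w j) (nth 0 w i).
  by case: (xi) lt => /=; clear - nE; lia.
rewrite rtableE // big_distrr; apply: eq_bigr => t _ /=.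
rewrite mulnb; congr nat_of_bool; rewrite -[xi in LHS]negbK.
apply/asboolP/andP.
  by case/(rollercoaster_turn (ne t) k0 h0); rewrite -?la // => -> H; split=> //; apply/asboolP.
case=> /eqP h1 /asboolP H.
by apply/(rollercoaster_turn (ne t) k0 h0); rewrite -?la.
Qed.

(** * Structured programs for the RAM *)

Notation cells := (nat -> nat).

(** Each control structure costs a single [IJlt], the only jump of the machine: hence a conditional
    that skips when the test holds, and a loop whose body runs at least once. *)
Inductive com :=
  | Blk of seq instr
  | Seq of com & com
  | Unless of nat & nat & com
  | DoWhile of com & nat & nat.

Definition basic (i : instr) : bool :=
  match i with IJlt _ _ _ | IHalt => false | _ => true end.

Definition sem (m : cells) (i : instr) : cells :=
  match i with
  | IConst d c => upd m d c
  | IAdd d a b => upd m d (m a + m b)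
  | ISub d a b => upd m d (m a - m b)
  | ILoad d a => upd m d (m (m a))
  | IStore a src => upd m (m a) (m src)
  | _ => m
  end.

Fixpoint clen (c : com) : nat :=
  match c with
  | Blk bl => size bl
  | Seq c1 c2 => clen c1 + clen c2
  | Unless _ _ c => (clen c).+1
  | DoWhile c _ _ => (clen c).+1
  end.

Fixpoint compile (p : nat) (c : com) : program :=
  match c with
  | Blk bl => bl
  | Seq c1 c2 => compile p c1 ++ compile (p + clen c1) c2
  | Unless a b c => IJlt a b (p.+1 + clen c) :: compile p.+1 c
  | DoWhile c a b => rcons (compile p c) (IJlt a b p)
  end.

Lemma size_compile p c : size (compile p c) = clen c.
Proof.
elim: c p => //= [c1 I1 c2 I2|a b c IH|c IH a b] p.
- by rewrite size_cat I1 I2.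
- by rewrite IH.
by rewrite size_rcons IH.
Qed.

Inductive bs : com -> cells -> nat -> cells -> Prop :=
  | bs_blk bl m : all basic bl -> bs (Blk bl) m (size bl) (foldl sem m bl)
  | bs_seq c1 c2 m t1 m1 t2 m2 :
      bs c1 m t1 m1 -> bs c2 m1 t2 m2 -> bs (Seq c1 c2) m (t1 + t2) m2
  | bs_skip a b c m : m a < m b -> bs (Unless a b c) m 1 m
  | bs_unless a b c m t m1 :
      m b <= m a -> bs c m t m1 -> bs (Unless a b c) m t.+1 m1
  | bs_exit c a b m t m1 :
      bs c m t m1 -> m1 b <= m1 a -> bs (DoWhile c a b) m t.+1 m1
  | bs_again c a b m t m1 t' m2 :
      bs c m t m1 -> m1 a < m1 b -> bs (DoWhile c a b) m1 t' m2 ->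
      bs (DoWhile c a b) m (t.+1 + t') m2.

Definition code_at (P : program) (p : nat) (c : program) : Prop :=
  forall j, j < size c -> nth IHalt P (p + j) = nth IHalt c j.

Lemma code_at_catl P p c1 c2 : code_at P p (c1 ++ c2) -> code_at P p c1.
Proof. by move=> H j lj; rewrite H ?nth_cat ?lj // size_cat ltn_addr. Qed.

Lemma code_at_catr P p c1 c2 :
  code_at P p (c1 ++ c2) -> code_at P (p + size c1) c2.
Proof.
move=> H j lj; rewrite -addnA H ?size_cat ?ltn_add2l //.
by rewrite nth_cat ltnNge leq_addr /= addKn.
Qed.

Lemma code_at_head P p i c : code_at P p (i :: c) -> nth IHalt P p = i.
Proof. by move=> /(_ 0); rewrite addn0; apply. Qed.

Lemma code_at_behead P p i c : code_at P p (i :: c) -> code_at P p.+1 c.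
Proof. by move=> H j lj; rewrite addSnnS H. Qed.

Lemma exec_basic P p m i r : nth IHalt P p = i -> basic i ->
  exec P r.+1 (State p m) = exec P r (State p.+1 (sem m i)).
Proof. by rewrite /= /halted /step /= => ->; case: i. Qed.

Lemma exec_jlt P p m a b l r : nth IHalt P p = IJlt a b l ->
  exec P r.+1 (State p m) = exec P r (State (if m a < m b then l else p.+1) m).
Proof. by rewrite /= /halted /step /= => ->. Qed.

Lemma exec_blk P p m bl r : code_at P p bl -> all basic bl ->
  exec P (size bl + r) (State p m) =
  exec P r (State (p + size bl) (foldl sem m bl)).
Proof.
elim: bl p m => [|i bl IH] p m H; first by rewrite /= addn0.
case/andP=> bi okb.
rewrite (_ : size _ + r = (size bl + r).+1) // (exec_basic _ _ (code_at_head H) bi).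
by rewrite IH ?[p + _]addnS //; apply: code_at_behead H.
Qed.

Lemma exec_compile P c m t m1 : bs c m t m1 ->
  forall p r, code_at P p (compile p c) ->
  exec P (t + r) (State p m) = exec P r (State (p + clen c) m1).
Proof.
elim=> {c m t m1}.
- by move=> bl m okb p r H; rewrite exec_blk.
- move=> c1 c2 m t1 m1 t2 m2 _ I1 _ I2 p r; rewrite [compile _ _]/= [clen _]/= => H.
  rewrite -addnA I1; last exact: code_at_catl H.
  have:= code_at_catr H; rewrite size_compile => H2.
  by rewrite I2 // addnA.
- move=> a b c m lt p r; rewrite [compile _ _]/= [clen _]/= => H.
  by rewrite (exec_jlt _ _ (code_at_head H)) lt addSnnS.
- move=> a b c m t m1 le _ IH p r; rewrite [compile _ _]/= [clen _]/= => H.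
  rewrite addSn (exec_jlt _ _ (code_at_head H)) ltnNge le /=.
  by rewrite IH ?addSnnS //; apply: code_at_behead H.
- move=> c a b m t m1 _ IH le p r; rewrite [compile _ _]/= [clen _]/= -cats1 => H.
  rewrite addSnnS IH; last exact: code_at_catl H.
  have:= code_at_catr H; rewrite size_compile => /code_at_head H2.
  by rewrite (exec_jlt _ _ H2) ltnNge le addnS.
move=> c a b m t m1 t' m2 _ IH lt _ IH' p r; rewrite [compile _ _]/= [clen _]/= => H.
move: (H); rewrite -cats1 => H1.
rewrite (_ : _ + r = t + (t' + r).+1); last lia.
rewrite IH; last exact: code_at_catl H1.
have:= code_at_catr H1; rewrite size_compile => /code_at_head H2.
by rewrite (exec_jlt _ _ H2) lt IH'.
Qed.

(* Cells below [size rs] are the registers, listed in [rs]; the others are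
   described by [h], so that a store through a pointer at least [size rs]
   leaves the list [rs] syntactically unchanged. *)
Definition rd (rs : seq nat) (h : cells) (a : nat) : nat := nth (h a) rs a.

(** Total correctness with time bound [t]. The final memory may be described with another number of
    registers than the initial one. *)
Definition tri (c : com) (rs : seq nat) (h : cells) (t : nat)
    (Q : seq nat -> cells -> Prop) : Prop :=
  forall m, m =1 rd rs h ->
  exists t' m' rs' h', [/\ bs c m t' m', t' <= t, m' =1 rd rs' h' & Q rs' h'].

Definition dst_ok (D : nat) (i : instr) : bool :=
  match i with
  | IConst d _ | IAdd d _ _ | ISub d _ _ | ILoad d _ => d < D
  | IStore _ _ => true
  | _ => false
  end.

Fixpoint wpb (bl : seq instr) (rs : seq nat) (h : cells)
    (Q : seq nat -> cells -> Prop) : Prop :=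
  match bl with
  | [::] => Q rs h
  | i :: bl' =>
    match i with
    | IConst d c => wpb bl' (set_nth 0 rs d c) h Q
    | IAdd d a b => wpb bl' (set_nth 0 rs d (rd rs h a + rd rs h b)) h Q
    | ISub d a b => wpb bl' (set_nth 0 rs d (rd rs h a - rd rs h b)) h Q
    | ILoad d a => size rs <= rd rs h a /\
        wpb bl' (set_nth 0 rs d (h (rd rs h a))) h Q
    | IStore a s => size rs <= rd rs h a /\
        wpb bl' rs (upd h (rd rs h a) (rd rs h s)) Q
    | _ => False
    end
  end.

Lemma rd_set_nth rs h d v : d < size rs ->
  rd (set_nth 0 rs d v) h =1 upd (rd rs h) d v.
Proof.
move=> ld a; rewrite /rd /upd.
have sz : size (set_nth 0 rs d v) = size rs by rewrite size_set_nth (maxn_idPr ld).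
case: (ltnP a (size rs)) => la; last first.
  by rewrite !nth_default ?sz //; case: eqP => // E; lia.
by rewrite !(set_nth_default 0 (h a)) ?sz // nth_set_nth.
Qed.

Lemma rd_heap rs h a : size rs <= a -> rd rs h a = h a.
Proof. by move=> la; rewrite /rd nth_default. Qed.

Lemma rd_upd rs h b v : size rs <= b -> rd rs (upd h b v) =1 upd (rd rs h) b v.
Proof.
move=> lb a; rewrite /rd /upd.
case: (ltnP a (size rs)) => la; last by rewrite !nth_default.
rewrite (set_nth_default (h a)) //; case: eqP => // E; lia.
Qed.

Lemma tri_blk bl rs h Q :
  all (dst_ok (size rs)) bl -> wpb bl rs h Q -> tri (Blk bl) rs h (size bl) Q.
Proof.
move=> ok wp m rm.
have okb : all basic bl by apply: sub_all ok; case.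
suff [rs' [h' [rm' q]]] : exists rs' h', foldl sem m bl =1 rd rs' h' /\ Q rs' h'.
  by exists (size bl), (foldl sem m bl), rs', h'; split=> //; apply: bs_blk.
have updE m1 m2 d v : m1 =1 m2 -> upd m1 d v =1 upd m2 d v.
  by move=> E x; rewrite /upd E.
elim: bl rs h m rm {okb} ok wp => [|i bl IH] rs h m rm ok wp.
  by exists rs, h.
case: i ok wp => [d c|d a b|d a b|d a|a s|a b l|] /andP[ld ok] //= wp.
1-3: apply: (IH _ _ _ _ _ wp); [|by rewrite size_set_nth (maxn_idPr ld)].
1-3: by move=> x; rewrite rd_set_nth // ?rm; apply: updE.
- case: wp => la wp; apply: (IH _ _ _ _ _ wp).
    move=> x; rewrite rd_set_nth // ?rm rd_heap //; exact: updE.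
  by rewrite size_set_nth (maxn_idPr ld).
case: wp => la wp; apply: (IH _ _ _ _ _ wp) => // x.
by rewrite rd_upd // !rm; apply: updE.
Qed.

Lemma tri_seq c1 c2 rs h t1 t2 Q :
  tri c1 rs h t1 (fun rs' h' => tri c2 rs' h' t2 Q) ->
  tri (Seq c1 c2) rs h (t1 + t2) Q.
Proof.
move=> T1 m /T1[t1' [m1 [rs1 [h1 [b1 l1 r1]]]]].
move=> /(_ _ r1)[t2' [m2 [rs2 [h2 [b2 l2 r2 q]]]]].
exists (t1' + t2'), m2, rs2, h2; split=> //; last exact: leq_add.
exact: bs_seq b2.
Qed.

Lemma tri_unless a b c rs h t Q :
  (rd rs h a < rd rs h b -> Q rs h) ->
  (rd rs h b <= rd rs h a -> tri c rs h t Q) ->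
  tri (Unless a b c) rs h t.+1 Q.
Proof.
move=> skip run m rm; case: (ltnP (m a) (m b)) => lt.
  exists 1, m, rs, h; split=> //; first exact: bs_skip.
  by apply: skip; rewrite -!rm.
have le : rd rs h b <= rd rs h a by rewrite -!rm.
case: (run le _ rm) => t' [m' [rs' [h' [b' l' r' q]]]].
by exists t'.+1, m', rs', h'; split=> //; apply: bs_unless.
Qed.

Lemma tri_weak c rs h t (Q : seq nat -> cells -> Prop) t' (Q' : seq nat -> cells -> Prop) :
  tri c rs h t Q -> t <= t' -> (forall rs h, Q rs h -> Q' rs h) -> tri c rs h t' Q'.
Proof.
move=> T le QQ m /T[t1 [m1 [rs1 [h1 [b1 l1 r1 q]]]]].
by exists t1, m1, rs1, h1; split=> //; [apply: leq_trans le|apply: QQ].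
Qed.

Lemma tri_view c rs h rs' h' t Q :
  rd rs h =1 rd rs' h' -> tri c rs' h' t Q -> tri c rs h t Q.
Proof. by move=> E T m rm; apply: T => a; rewrite rm E. Qed.

Lemma tri_for (Inv : nat -> seq nat -> cells -> Prop) N c a b rs h t
    (Q : seq nat -> cells -> Prop) :
  0 < N -> Inv 0 rs h ->
  (forall j rs h, j < N -> Inv j rs h ->
     tri c rs h t (fun rs' h' =>
       Inv j.+1 rs' h' /\ (rd rs' h' a < rd rs' h' b) = (j.+1 < N))) ->
  (forall rs h, Inv N rs h -> Q rs h) ->
  tri (DoWhile c a b) rs h (N * t.+1) Q.
Proof.
move=> N0 I0 step fin.
suff loop d : forall j rs h, j < N -> N - j = d -> Inv j rs h ->
    tri (DoWhile c a b) rs h (d * t.+1) Q by exact: (loop _ 0 _ _ N0 (subn0 _) I0).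
elim: d => [|d IH] j rs1 h1 lj E Ij m rm; first lia.
case: (step _ _ _ lj Ij _ rm) => t1 [m1 [rs2 [h2 [b1 l1 r1 [I1]]]]].
rewrite -!r1 => cond.
case: (ltnP j.+1 N) cond => lj1 cond.
  have [|t2 [m2 [rs3 [h3 [b2 l2 r2 q]]]]] := IH j.+1 rs2 h2 lj1 _ I1 _ r1; first lia.
  exists (t1.+1 + t2), m2, rs3, h3; split=> //; first exact: bs_again b2.
  by rewrite mulSn leq_add.
exists t1.+1, m1, rs2, h2; split=> //.
- by apply: bs_exit => //; rewrite leqNgt cond.
- by rewrite mulSn (leq_trans _ (leq_addr _ _)).
by apply: fin; rewrite (_ : N = j.+1) //; lia.
Qed.

(** * The program *)

(* Cell 3 holds the constant 1, cell 18 the constant 0, cell 4 the row length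
   2k, cell 9 the output row of position i and cell 8 its second half.  The row
   kept for the letter y >= 1 starts at V + 2k * y; the row at V stays zero and
   serves as a source of zeros. *)
Definition regs n s k x pw pd po i V y p t q v v2 a b c d x1 y1 : seq nat :=
  [:: n; s; k; 1; k + k; x; pw; 51 + n; pd; po; i; V; y; p; t; q; v; v2; 0;
      a; b; c; d; x1; y1; s.+1; k - 2].

Ltac evals := lazy beta iota zeta delta [wpb rd nth set_nth regs size].
Ltac run_block := apply: tri_blk; [exact: isT | evals].

(** The first entry is read at cell 19, the following ones from the address in cell 20 on. With this
    separate source for the first entry, copying, shifting and reducing to one entry are the same
    loop. *)
Definition add_row : com :=
  Seq (Blk [:: IConst 14 0])
    (DoWhile (Blk [:: ILoad 16 19; ILoad 17 13; IAdd 16 16 17; IStore 13 16;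
                      IAdd 13 13 3; IAdd 19 20 18; IAdd 20 20 3; IAdd 14 14 3]) 14 2).

Lemma tri_add_row n s k x pw pd po i V y p t q v v2 a b c d x1 y1 h
    (Q : seq nat -> cells -> Prop) :
  0 < k -> 27 <= a -> 27 <= b -> a < p -> b + k.-1 <= p ->
  (forall a' b' v v2 h',
     (forall z, h' z = if p <= z < p + k
        then h z + h (if z == p then a else b + (z - p).-1) else h z) ->
     Q (regs n s k x pw pd po i V y (p + k) k q v v2 a' b' c d x1 y1) h') ->
  tri add_row (regs n s k x pw pd po i V y p t q v v2 a b c d x1 y1) h (1 + k * 9) Q.
Proof.
move=> k0 a27 b27 ap bp fin; apply: tri_seq; run_block.
pose src j := if j == 0 then a else b + j.-1.
have srcP j : j < k -> 27 <= src j /\ src j < p.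
  by rewrite /src => jk; clear - a27 b27 ap bp jk; case: eqP => ?; lia.
pose Inv j rs h' := exists v v2,
  rs = regs n s k x pw pd po i V y (p + j) j q v v2 (src j) (b + j) c d x1 y1 /\
  forall z, h' z = if p <= z < p + j then h z + h (src (z - p)) else h z.
apply: (tri_for (Inv := Inv) k0).
- exists v, v2; split; first by rewrite !addn0.
  by move=> z; rewrite addn0 ifF //; clear; lia.
- move=> j rs h' jk [v' [v2' [-> hz]]]; have [sa sp] := srcP j jk.
  run_block; split=> //; split; first by clear - sa sp; lia.
  split; first by clear - sa sp; lia.
  split; last by evals; rewrite addn1.
  exists (h' (src j) + h' (p + j)), (h' (p + j)).
  split; first by rewrite addn0 !addn1 !addnS.
  move=> z; rewrite /upd; case: eqP => [->|nz].
    rewrite !hz ltnn andbF (_ : (p <= src j < _) = false); last by clear - sp; lia.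
    by rewrite (_ : (p <= p + j < _) = true) ?addKn 1?addnC //; clear; lia.
  by rewrite hz; congr (if _ then _ else _); clear - nz; lia.
move=> rs h' [v' [v2' [-> hz]]]; apply: fin => z; rewrite hz.
case: ifP => // /andP[pz _]; congr (_ + h _); rewrite /src.
by rewrite subn_eq0 eqn_leq pz andbT.
Qed.

(* What the row [r] of a position carrying letter [x] adds to the row of a
   later position carrying letter [y]: entry [u < k] is (up, u + 1) and entry
   [k + u] is (down, u + 1), so that [k - 2] stands for the level max(1, k - 1). *)
Definition contrib (k : nat) (r : nat -> nat) (x y u : nat) : nat :=
  if u < k then
    if x == y then r u else if x < y then r u.-1 else (u == 0) * r (k + (k - 2))
  else
    if x == y then r u else if x < y then (u == k) * r (k - 2) else r (k + (u - k).-1).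

Lemma eq_contrib k r r' x y u : 0 < k -> u < k + k ->
  (forall v, v < k + k -> r v = r' v) -> contrib k r x y u = contrib k r' x y u.
Proof.
move=> k0 uk E; rewrite /contrib !E //; clear - k0 uk; lia.
Qed.

Definition add_rows : com :=
  Seq add_row (Seq (Blk [:: IAdd 19 21 18; IAdd 20 22 18])
    (Seq add_row (Blk [:: IAdd 12 24 18]))).

Lemma tri_add_rows n s k x pw pd po i V y p t q v v2 a b c d x1 y1 h
    (Q : seq nat -> cells -> Prop) :
  0 < k -> 27 <= a -> 27 <= b -> a < p -> b + k.-1 <= p ->
  27 <= c -> 27 <= d -> c < p -> d + k.-1 <= p ->
  (forall a' b' v v2 h',
     (forall u, u < k -> h' (p + u) = h (p + u) + h (if u == 0 then a else b + u.-1)) ->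
     (forall u, u < k ->
        h' (p + k + u) = h (p + k + u) + h (if u == 0 then c else d + u.-1)) ->
     (forall z, ~~ (p <= z < p + k + k) -> h' z = h z) ->
     Q (regs n s k x pw pd po i V y1 (p + k + k) k q v v2 a' b' c d x1 y1) h') ->
  tri add_rows (regs n s k x pw pd po i V y p t q v v2 a b c d x1 y1) h (18 * k + 5) Q.
Proof.
move=> k0 a27 b27 ap bp c27 d27 cp dp fin.
have eqz P u : (P + u == P) = (u == 0) by rewrite -{2}[P]addn0 eqn_add2l.
have -> : 18 * k + 5 = (1 + k * 9) + (2 + ((1 + k * 9) + 1)) by clear; lia.
apply: tri_seq; apply: tri_add_row => // a1 b1 v1 w1 h1 H1.
apply: tri_seq; run_block; rewrite !addn0 -/(regs n s k x pw pd po i V y _ _ _ _ _ c d c d x1 y1).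
apply: tri_seq; apply: tri_add_row => //; [lia|lia|] => a2 b2 v3 w3 h2 H2.
run_block; rewrite addn0; apply: fin.
- move=> u uk; rewrite H2 ifF; last by clear - uk; lia.
  rewrite H1 ifT; last by clear - uk; lia.
  by rewrite eqz addKn.
- move=> u uk; rewrite H2 ifT; last by clear - uk; lia.
  rewrite eqz addKn !H1.
  rewrite ifF; last by clear; lia.
  case: eqP => [_|/eqP u0]; first by rewrite ifF //; clear - cp; lia.
  by rewrite ifF //; apply/negbTE; rewrite negb_and -ltnNge; clear - dp uk u0; lia.
move=> z zp; rewrite H2 ifF; last by clear - zp; lia.
by rewrite H1 ifF //; clear - zp; lia.
Qed.

(** The initial sources copy both halves, as needed for [y = x]. For [y > x] the up half is shifted,
    its entry 0 being read twice, and the down half gets entry [k - 2] of the up half followed by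
    zeros read at [V]; for [y < x] the halves exchange roles. *)
Definition push_letter : com :=
  Seq (Blk [:: IAdd 24 12 3; IAdd 19 9 18; IAdd 20 9 3; IAdd 21 8 18; IAdd 22 8 3])
  (Seq (Unless 12 23 (Blk [:: IAdd 20 9 18; IAdd 21 9 26; IAdd 22 11 18]))
  (Seq (Unless 5 24 (Blk [:: IAdd 19 8 26; IAdd 20 11 18; IAdd 22 8 18]))
   add_rows)).

Lemma tri_push_letter n s k x pw po i V y p t q v v2 a b c d y1 h
    (Q : seq nat -> cells -> Prop) :
  0 < k -> 27 <= po -> po + (k + k) <= V -> V + k <= p ->
  (forall u, u < k -> h (V + u) = 0) ->
  (forall v v2 a b c d y1 h',
     (forall u, u < k + k ->
        h' (p + u) = h (p + u) + contrib k (fun u => h (po + u)) x y u) ->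
     (forall z, ~~ (p <= z < p + (k + k)) -> h' z = h z) ->
     Q (regs n s k x pw (po + k) po i V y.+1 (p + (k + k)) k q v v2 a b c d x.+1 y1) h') ->
  tri push_letter (regs n s k x pw (po + k) po i V y p t q v v2 a b c d x.+1 y1) h
    (18 * k + 18) Q.
Proof.
move=> k0 po27 poV Vp zero fin.
have -> : 18 * k + 18 = 5 + (4 + (4 + (18 * k + 5))) by clear; lia.
apply: tri_seq; run_block; rewrite !addn0 !addn1.
rewrite -/(regs n s k x pw (po + k) po i V y p t q v v2 po po.+1 (po + k) (po + k).+1 x.+1 y.+1).
have run a' b' c' d' : 27 <= a' -> 27 <= b' -> a' < p -> b' + k.-1 <= p ->
    27 <= c' -> 27 <= d' -> c' < p -> d' + k.-1 <= p ->
    (forall u, u < k -> h (if u == 0 then a' else b' + u.-1) =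
                        contrib k (fun u => h (po + u)) x y u) ->
    (forall u, u < k -> h (if u == 0 then c' else d' + u.-1) =
                        contrib k (fun u => h (po + u)) x y (k + u)) ->
  tri add_rows
    (regs n s k x pw (po + k) po i V y p t q v v2 a' b' c' d' x.+1 y.+1) h (18 * k + 5) Q.
  move=> h1 h2 h3 h4 h5 h6 h7 h8 up dn; apply: tri_add_rows => //.
  move=> a2 b2 v3 w3 h' U D O; rewrite -addnA; apply: fin.
    move=> u uk; case: (ltnP u k) => lu; first by rewrite U ?up.
    by rewrite -(subnKC lu) addnA D ?dn //; clear - lu uk; lia.
  by move=> z; rewrite addnA; apply: O.
have eqk u : (k + u == k) = (u == 0) by rewrite -{2}[k]addn0 eqn_add2l.
clear fin; case: (ltngtP x y) => xy.
- have nyx : (y < x.+1) = false by clear - xy; lia.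
  have lxy : (x < y.+1) by clear - xy; lia.
  apply: tri_seq; apply: tri_unless; evals; first by rewrite nyx.
  move=> _; run_block; rewrite !addn0.
  rewrite -/(regs n s k x pw (po + k) po i V y p t q v v2 po po (po + (k - 2)) V x.+1 y.+1).
  apply: tri_seq; apply: tri_unless; evals; last by rewrite leqNgt lxy.
  move=> _; apply: run; try (clear - k0 po27 poV Vp; lia).
    move=> u uk; rewrite /contrib uk (ltn_eqF xy) xy.
    by case: (u) => [|u'] //=; rewrite addn0.
  move=> u uk; rewrite /contrib ltnNge leq_addr (ltn_eqF xy) xy /= eqk.
  by case: (u) uk => [|u'] uk /=; rewrite ?mul1n // zero //; clear - uk; lia.
- have yx1 : (y < x.+1) by clear - xy; lia.
  have nxy1 : (x < y.+1) = false by clear - xy; lia.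
  have nxy : (x < y) = false by clear - xy; lia.
  apply: tri_seq; apply: tri_unless; evals; last by rewrite leqNgt yx1.
  move=> _; apply: tri_seq; apply: tri_unless; evals; first by rewrite nxy1.
  move=> _; run_block; rewrite !addn0.
  apply: run; try (clear - k0 po27 poV Vp; lia).
    move=> u uk; rewrite /contrib uk (gtn_eqF xy) nxy.
    by case: (u) uk => [|u'] uk /=; rewrite ?mul1n ?addnA // zero //; clear - uk; lia.
  move=> u uk; rewrite /contrib ltnNge leq_addr (gtn_eqF xy) nxy /= addKn.
  by case: (u) => [|u'] /=; rewrite ?addn0 ?addnA.
have yx1 : (y < x.+1) by rewrite xy.
have xy1 : (x < y.+1) by rewrite xy.
apply: tri_seq; apply: tri_unless; evals; last by rewrite leqNgt yx1.
move=> _; apply: tri_seq; apply: tri_unless; evals; last by rewrite leqNgt xy1.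
move=> _; apply: run; try (clear - k0 po27 poV Vp; lia).
  move=> u uk; rewrite /contrib uk xy eqxx.
  by case: (u) => [|u'] /=; rewrite ?addn0 // addSnnS.
move=> u uk; rewrite /contrib ltnNge leq_addr xy eqxx /=.
by case: (u) => [|u'] /=; rewrite ?addn0 // addSnnS addnA.
Qed.

Definition push_all : com := DoWhile push_letter 12 25.

Lemma tri_push_all n s k x pw po i V p t q v v2 a b c d y1 h
    (Q : seq nat -> cells -> Prop) :
  0 < k -> 0 < s -> 27 <= po -> po + (k + k) <= V ->
  p = V + (k + k) ->
  (forall u, u < k + k -> h (V + u) = 0) ->
  (forall p t v v2 a b c d y1 h',
     (forall y u, 0 < y <= s -> u < k + k ->
        h' (V + (k + k) * y + u) =
        h (V + (k + k) * y + u) + contrib k (fun u => h (po + u)) x y u) ->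
     (forall z, z < V + (k + k) -> h' z = h z) ->
     Q (regs n s k x pw (po + k) po i V s.+1 p t q v v2 a b c d x.+1 y1) h') ->
  tri push_all (regs n s k x pw (po + k) po i V 1 p t q v v2 a b c d x.+1 y1) h
    (s * (18 * k + 19)) Q.
Proof.
move=> k0 s0 po27 poV pE zero fin.
pose Inv j rs h' := exists t v v2 a b c d y1,
  rs = regs n s k x pw (po + k) po i V j.+1 (V + (k + k) * j.+1) t q v v2
         a b c d x.+1 y1 /\
  [/\ forall y u, 0 < y <= j -> u < k + k ->
        h' (V + (k + k) * y + u) =
        h (V + (k + k) * y + u) + contrib k (fun u => h (po + u)) x y u,
      forall z, V + (k + k) * j.+1 <= z -> h' z = h z
    & forall z, z < V + (k + k) -> h' z = h z].
have -> : s * (18 * k + 19) = s * (18 * k + 18).+1 by rewrite -addnS.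
apply: (tri_for (Inv := Inv) s0).
- exists t, v, v2, a, b, c, d, y1; rewrite pE muln1; split=> //; split=> // y u.
  by clear; lia.
- move=> j rs h' js [t' [v' [w' [a' [b' [c' [d' [y1' [-> [H1 H2 H3]]]]]]]]]].
  have VK : V + (k + k) <= V + (k + k) * j.+1 by rewrite leq_add2l mulnS leq_addr.
  have low u : u < k + k -> po + u < V + (k + k) by clear - poV; lia.
  apply: tri_push_letter => //.
  + by apply: leq_trans VK; clear; lia.
  + by move=> u uk; rewrite H3 ?zero //; clear - uk; lia.
  move=> v3 w3 a3 b3 c3 d3 y3 h3 N O; split; last by evals.
  exists k, v3, w3, a3, b3, c3, d3, y3.
  rewrite [_ * j.+2]mulnSr [V + (_ + (k + k))]addnA; split=> //; split.
  + move=> y u /andP[y0]; rewrite leq_eqVlt => /orP[/eqP->|yj] uk.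
      rewrite N // H2 ?leq_addr //; congr (_ + _); apply: eq_contrib => // u' uk'.
      by rewrite H3 // low.
    rewrite O ?H1 ?y0 //.
    have : (k + k) * y.+1 <= (k + k) * j.+1 by rewrite leq_mul2l yj orbT.
    by rewrite mulnSr; clear - uk; set Y := _ * y; set J := _ * j.+1; clearbody Y J; lia.
  + move=> z Hz; rewrite O ?H2 //; last by rewrite negb_and -leqNgt Hz orbT.
    by apply: leq_trans Hz; apply: leq_addr.
  move=> z Hz; rewrite O ?H3 //.
  by rewrite negb_and -ltnNge (leq_trans Hz VK).
move=> rs h' [t' [v' [w' [a' [b' [c' [d' [y1' [-> [H1 H2 H3]]]]]]]]]].
exact: fin.
Qed.

(** Repeated addition replaces the product [2k * x]; since [x <= sigma], it fits in the time allowed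
    per position. *)
Definition find_row : com := DoWhile (Blk [:: IAdd 13 13 4; IAdd 12 12 3]) 12 5.

Lemma tri_find_row n s k x pw pd po i V t q v v2 a b c d x1 y1 h
    (Q : seq nat -> cells -> Prop) : 0 < x ->
  Q (regs n s k x pw pd po i V x (V + (k + k) * x) t q v v2 a b c d x1 y1) h ->
  tri find_row (regs n s k x pw pd po i V 0 V t q v v2 a b c d x1 y1) h (x * 3) Q.
Proof.
move=> x0 fin.
pose Inv j rs (h' : cells) := h' = h /\
  rs = regs n s k x pw pd po i V j (V + (k + k) * j) t q v v2 a b c d x1 y1.
apply: (tri_for (Inv := Inv) x0).
- by split=> //; rewrite muln0 addn0.
- move=> j rs h' jx [-> ->]; run_block; split; last by rewrite addn1.
  by split=> //; rewrite addn1 mulnSr [V + (_ + (k + k))]addnA.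
by move=> rs h' [-> ->].
Qed.

Definition copy_row : com :=
  DoWhile (Blk [:: ILoad 16 13; IStore 15 16; IAdd 13 13 3; IAdd 15 15 3; IAdd 14 14 3]) 14 4.

Lemma tri_copy_row n s k x pw pd po i V y p q v v2 a b c d x1 y1 h
    (Q : seq nat -> cells -> Prop) :
  0 < k -> 27 <= q -> q + (k + k) <= p ->
  (forall p' t q' v h',
     (forall u, u < k + k -> h' (q + u) = h (p + u)) ->
     (forall z, ~~ (q <= z < q + (k + k)) -> h' z = h z) ->
     Q (regs n s k x pw pd po i V y p' t q' v v2 a b c d x1 y1) h') ->
  tri copy_row (regs n s k x pw pd po i V y p 0 q v v2 a b c d x1 y1) h
    ((k + k) * 6) Q.
Proof.
move=> k0 q27 qp fin.
pose Inv j rs h' := exists v,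
  rs = regs n s k x pw pd po i V y (p + j) j (q + j) v v2 a b c d x1 y1 /\
  [/\ forall u, u < j -> h' (q + u) = h (p + u)
    & forall z, ~~ (q <= z < q + j) -> h' z = h z].
apply: (tri_for (Inv := Inv) (N := k + k)); first by rewrite addn_gt0 k0.
- by exists v; rewrite !addn0; split.
- move=> j rs h' jk [v' [-> [H1 H2]]].
  run_block; split; first by clear - q27 qp; lia.
  split; first by clear - q27; lia.
  split; last by evals; rewrite addn1.
  exists (h' (p + j)); rewrite !addn1 -!addnS; split=> //; split.
    move=> u; rewrite ltnS leq_eqVlt /upd => /orP[/eqP->|uj].
      by rewrite eqxx H2 //; clear - jk qp; lia.
    by rewrite eqn_add2l (ltn_eqF uj) H1.
  move=> z zq; rewrite /upd ifF ?H2 //; clear - zq; lia.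
by move=> rs h' [v' [-> [H1 H2]]]; apply: fin.
Qed.

(* The first 24 input letters leave room for the registers and are moved behind
   the others. *)
Definition addr (n i : nat) : nat := if i < 24 then 27 + n + i else 3 + i.

Lemma addr_ge n i : 27 <= addr n i.
Proof. by rewrite /addr; case: (ltnP i 24); lia. Qed.

Lemma addr_lt n i : i < n -> addr n i < 51 + n.
Proof. by rewrite /addr; case: (ltnP i 24); lia. Qed.

(** The moved letters fill the cells up to [50 + n]; on reaching [51 + n] the pointer jumps to cell
    27, where letter 24 was from the start. *)
Definition next_letter : com :=
  Seq (Blk [:: ILoad 5 6; IAdd 6 6 3]) (Unless 6 7 (Blk [:: IConst 6 27])).

Lemma tri_next_letter n s k x pd po i V y p t q v v2 a b c d x1 y1 h
    (Q : seq nat -> cells -> Prop) : i < n ->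
  Q (regs n s k (h (addr n i)) (addr n i.+1) pd po i V y p t q v v2 a b c d x1 y1) h ->
  tri next_letter (regs n s k x (addr n i) pd po i V y p t q v v2 a b c d x1 y1) h 4 Q.
Proof.
move=> li fin; rewrite -[4]/(2 + 2); apply: tri_seq; run_block.
split; first exact: addr_ge.
apply: tri_unless; evals => H; [|run_block]; move: fin.
  suff -> : addr n i.+1 = addr n i + 1 by [].
  by move: H li; rewrite /addr; clear; case: (ltnP i 24); case: (ltnP i.+1 24); lia.
suff -> : addr n i.+1 = 27 by [].
by move: H li; rewrite /addr; clear; case: (ltnP i 24); case: (ltnP i.+1 24); lia.
Qed.

(** The two increments count the one-letter subsequence at this position, which has level 1 for both
    orientations. *)
Definition fill_row : com :=
  Seq (Blk [:: IAdd 13 11 18; IConst 12 0]) (Seq find_row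
  (Seq (Blk [:: IAdd 15 9 18; IConst 14 0]) (Seq copy_row
  (Blk [:: ILoad 16 9; IAdd 16 16 3; IStore 9 16;
           IAdd 8 9 2; ILoad 16 8; IAdd 16 16 3; IStore 8 16])))).

Lemma tri_fill_row n s k x pw pd po i V y p t q v v2 a b c d x1 y1 h
    (Q : seq nat -> cells -> Prop) :
  0 < k -> 0 < x -> 27 <= po -> po + (k + k) <= V ->
  (forall y p t q v h',
     (forall u, u < k + k ->
        h' (po + u) = ((u == 0) || (u == k)) + h (V + (k + k) * x + u)) ->
     (forall z, ~~ (po <= z < po + (k + k)) -> h' z = h z) ->
     Q (regs n s k x pw (po + k) po i V y p t q v v2 a b c d x1 y1) h') ->
  tri fill_row (regs n s k x pw pd po i V y p t q v v2 a b c d x1 y1) h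
    (3 * x + 12 * k + 11) Q.
Proof.
move=> k0 x0 po27 poV fin.
have -> : 3 * x + 12 * k + 11 = 2 + (x * 3 + (2 + ((k + k) * 6 + 7))).
  by clear; lia.
apply: tri_seq; run_block; rewrite addn0.
apply: tri_seq; apply: tri_find_row => //.
apply: tri_seq; run_block; rewrite addn0.
apply: tri_seq; apply: tri_copy_row => //; first by rewrite (leq_trans poV) // leq_addr.
move=> p' t' q' v' h' H1 H2; run_block.
have k00 : (k == 0) = false by clear - k0; lia.
split=> //; split=> //; split; first by rewrite (leq_trans po27) // leq_addr.
split; first by rewrite (leq_trans po27) // leq_addr.
apply: fin.
  have e0 m : (po + m == po) = (m == 0) by rewrite -{2}[po]addn0 eqn_add2l.
  move=> u uk; rewrite /upd eqn_add2l !e0 k00.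
  case: eqP => [->|_]; first by rewrite k00 H1 1?addnC // -{1}[k]addn0 ltn_add2l.
  case: eqP => [E|_]; last by rewrite H1.
  by rewrite -H1 // E addn0 addnC.
move=> z zp; rewrite /upd ifF; last by clear - zp k0; lia.
by rewrite ifF ?H2 //; clear - zp k0; lia.
Qed.

Definition fill_table : com :=
  DoWhile (Seq next_letter (Seq fill_row
    (Seq (Blk [:: IAdd 13 11 4; IConst 12 1; IAdd 23 5 3])
    (Seq push_all (Blk [:: IAdd 9 9 4; IAdd 10 10 3]))))) 10 0.

Lemma tri_fill_table n s k W R x pd y p t q v v2 a b c d x1 y1 h
    (Q : seq nat -> cells -> Prop) :
  let O := 51 + n in let V := O + (k + k) * n in
  0 < n -> 0 < k -> (forall i, i < n -> 0 < W i <= s) ->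
  (forall i u, i < n -> u < k + k ->
     R i u = ((u == 0) || (u == k)) + \sum_(j < i) contrib k (R j) (W j) (W i) u) ->
  (forall j, j < n -> h (addr n j) = W j) ->
  (forall z, V <= z -> h z = 0) ->
  (forall x pw pd po i y p t q v v2 a b c d x1 y1 h',
     (forall j u, j < n -> u < k + k -> h' (O + (k + k) * j + u) = R j u) ->
     Q (regs n s k x pw pd po i V y p t q v v2 a b c d x1 y1) h') ->
  tri fill_table (regs n s k x (addr n 0) pd O 0 V y p t q v v2 a b c d x1 y1) h
    (n * (73 * (s * k))) Q.
Proof.
move=> O V n0 k0 Ws Rrec hW hV fin.
have s0 : 0 < s by have /andP[] := Ws 0 n0; apply: leq_trans.
pose Inv i rs h' := exists x pd y p t q v v2 a b c d x1 y1,
  rs = regs n s k x (addr n i) pd (O + (k + k) * i) i V y p t q v v2 a b c d x1 y1 /\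
  [/\ forall j, j < n -> h' (addr n j) = W j,
      forall j u, j < i -> u < k + k -> h' (O + (k + k) * j + u) = R j u,
      forall u, u < k + k -> h' (V + u) = 0
    & forall y u, 0 < y <= s -> u < k + k ->
        h' (V + (k + k) * y + u) = \sum_(j < i) contrib k (R j) (W j) y u].
pose T := 4 + ((3 * s + 12 * k + 11) + (3 + (s * (18 * k + 19) + 2))).
apply: (@tri_weak _ _ _ (n * T.+1) Q) => //; last first.
  (* One iteration costs [21 + 22 s + 12 k + 18 s k], and [73 = 21 + 22 + 12 + 18] because [s] and
     [k] are positive. *)
  rewrite leq_mul2l; apply/orP; right.
  have : s <= s * k by rewrite leq_pmulr.
  have : k <= s * k by rewrite leq_pmull.
  rewrite /T mulnDr [s * (18 * k)]mulnCA; move: s0 k0; clear.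
  by move: (s * k) => sk; lia.
apply: (tri_for (Inv := Inv) n0).
- exists x, pd, y, p, t, q, v, v2, a, b, c, d, x1, y1.
  rewrite muln0 addn0; split=> //; split=> //.
    by move=> u _; rewrite hV // leq_addr.
  by move=> y' u _ _; rewrite big_ord0 hV // -addnA leq_addr.
- move=> i rs h' li [x' [pd' [y' [p' [t' [q' [v' [w' [a' [b' [c' [d' [x1' [y1' [->]]]]]]]]]]]]]]].
  case=> I1 I2 I3 I4.
  have /andP[W0 Wle] := Ws i li.
  have OV : O + (k + k) * i + (k + k) <= V.
    by rewrite -addnA -mulnSr leq_add2l leq_mul2l li orbT.
  have O27 : 27 <= O + (k + k) * i by rewrite /O; clear; lia.
  have addrO j : j < n -> addr n j < O + (k + k) * i.
    by move=> /addr_lt lj; rewrite (leq_trans lj) // leq_addr.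
  apply: tri_seq; apply: tri_next_letter => //; rewrite I1 //.
  apply: tri_seq.
  have lT : 3 * W i + 12 * k + 11 <= 3 * s + 12 * k + 11.
    by rewrite !leq_add2r leq_mul2l Wle.
  apply: tri_weak lT (fun _ _ H => H); apply: tri_fill_row => //.
  move=> y2 p2 t2 q2 v2' h2 F1 F2.
  have {}F1 u : u < k + k -> h2 (O + (k + k) * i + u) = R i u.
    by move=> uk; rewrite F1 // I4 ?W0 // Rrec.
  have F2l z : z < O + (k + k) * i -> h2 z = h' z.
    by move=> zl; rewrite F2 //; clear - zl; lia.
  have F2V z : h2 (V + z) = h' (V + z).
    by rewrite F2 //; clear - OV; lia.
  apply: tri_seq; run_block; rewrite addn1.
  rewrite -/(regs n s k (W i) (addr n i.+1) (O + (k + k) * i + k) (O + (k + k) * i) i V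
     1 (V + (k + k)) t2 q2 v2' w' a' b' c' d' (W i).+1 y1').
  apply: tri_seq; apply: tri_push_all => //; first by move=> u uk; rewrite F2V I3.
  move=> p3 t3 v3 w3 a3 b3 c3 d3 y3 h3 P1 P2.
  run_block; split; last by evals; rewrite addn1.
  exists (W i), (O + (k + k) * i + k), s.+1, p3, t3, q2, v3, w3, a3, b3, c3, d3, (W i).+1, y3.
  rewrite addn1 mulnSr [O + (_ + (k + k))]addnA; split=> //.
  have P2O z : z < O + (k + k) * i + (k + k) -> h3 z = h2 z.
    by move=> zl; rewrite P2 //; clear - zl OV; lia.
  split.
  + move=> j lj; rewrite P2O ?F2l ?I1 ?addrO //.
    by rewrite (leq_trans (addrO j lj)) // leq_addr.
  + move=> j u; rewrite ltnS leq_eqVlt => /orP[/eqP->|ji] uk.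
      by rewrite P2O ?F1 // ltn_add2l.
    have lz : O + (k + k) * j + u < O + (k + k) * i.
      have : (k + k) * j.+1 <= (k + k) * i by rewrite leq_mul2l ji orbT.
      rewrite mulnSr; clear - uk; set A := _ * j; set B := _ * i; clearbody A B O; lia.
    by rewrite P2O ?F2l ?I2 // (leq_trans lz) // leq_addr.
  + by move=> u uk; rewrite P2 ?ltn_add2l // F2V I3.
  move=> y4 u y4s uk; rewrite P1 // -addnA F2V addnA I4 // big_ord_recr /=.
  by congr (_ + _); apply: eq_contrib.
move=> rs h' [x' [pd' [y' [p' [t' [q' [v' [w' [a' [b' [c' [d' [x1' [y1' [->]]]]]]]]]]]]]]].
case=> I1 I2 I3 I4; exact: fin.
Qed.

(** * Freeing the low cells, and writing the table back behind them *)

Lemma wpb_cat bl1 bl2 rs h Q :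
  wpb bl1 rs h (fun rs h => wpb bl2 rs h Q) -> wpb (bl1 ++ bl2) rs h Q.
Proof.
elim: bl1 rs h => [//|i bl1 IH] rs h.
by case: i => //= [d c|d a b|d a b|d a [? H]|a s [? H]]; try split=> //; apply: IH.
Qed.

(** Used to turn cells 3 to 26 into registers once their letters have been moved. *)
Lemma rd_more D rs h : size rs <= D -> rd rs h =1 rd (mkseq (rd rs h) D) h.
Proof.
move=> le a; rewrite {2}/rd; case: (ltnP a D) => la; first by rewrite nth_mkseq.
by rewrite nth_default ?size_mkseq // rd_heap // (leq_trans le).
Qed.

(** Used to return registers to the heap, so that the output may overwrite them. *)
Lemma rd_less D rs h : rd rs h =1 rd (take D rs) (rd rs h).
Proof.
move=> a; rewrite {2}/rd; case: (ltnP a (size (take D rs))) => la.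
  rewrite (set_nth_default (h a)) // nth_take //.
  by move: la; rewrite size_take_min leq_min => /andP[].
by rewrite nth_default.
Qed.

(* The pointer reached by [save m] below. *)
Fixpoint far (m n k : nat) : nat :=
  if m is m'.+1 then far m' (n + k) (k + (n + k)) else k.

(* With only the cells 0, 1, 2 free, and holding n, sigma and k, a pointer
   beyond the input is reached by additions that can be undone. *)
Fixpoint save (m : nat) : seq instr :=
  if m is m'.+1 then
    [:: IAdd 0 0 2; IAdd 2 2 0] ++ (save m' ++ [:: ISub 2 2 0; ISub 0 0 2])
  else [:: IStore 2 1].

Lemma wpb_save m n s k h Q : 3 <= far m n k ->
  Q [:: n; s; k] (upd h (far m n k) s) -> wpb (save m) [:: n; s; k] h Q.
Proof.
elim: m n k Q => [|m IH] n k Q /= f3 q; first by [].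
rewrite /rd /=; apply: wpb_cat; apply: IH => //.
by rewrite /= /rd /= !addnK.
Qed.

(** Once [sigma] is saved, cell 1 can serve as pointer. The targets start at [27 + n], beyond the
    input. *)
Definition move_cells (L : nat) : seq instr :=
  flatten [seq [:: IConst 1 (27 + j); IAdd 1 1 0; IStore 1 (3 + j)] | j <- iota 0 L].

Lemma wpb_move_cells L n s k h (Q : seq nat -> cells -> Prop) : L <= 24 ->
  (forall c h', (forall z, h' z = if 27 + n <= z < 27 + n + L
                    then h (z - (27 + n) + 3) else h z) ->
     Q [:: n; c; k] h') ->
  wpb (move_cells L) [:: n; s; k] h Q.
Proof.
elim: L Q => [|L IH] Q lL fin.
  by apply: fin => z; rewrite ifF //; clear; lia.
rewrite /move_cells -[L.+1]addn1 iotaD map_cat flatten_cat; apply: wpb_cat.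
apply: IH => [|c h' H]; first exact: ltnW.
rewrite /= !add0n; split; first by rewrite /rd /=; clear; lia.
rewrite (@rd_heap _ _ (3 + L)) //; apply: fin => z; rewrite /upd /rd.
lazy beta iota delta [nth].
case: eqP => [->|nz].
  rewrite ifT; last by clear; lia.
  rewrite H ifF; last by clear - lL; lia.
  by congr h; clear; lia.
by rewrite H; congr (if _ then _ else _); clear - nz; lia.
Qed.

Lemma wpb_relocate m L n s k h (Q : seq nat -> cells -> Prop) :
  3 <= far m n k -> L <= 24 ->
  (forall c h', (forall z, h' z = if 27 + n <= z < 27 + n + L
                    then upd h (far m n k) s (z - (27 + n) + 3)
                    else upd h (far m n k) s z) ->
     Q [:: n; c; k] h') ->
  wpb (save m ++ move_cells L) [:: n; s; k] h Q.
Proof.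
by move=> f3 lL fin; apply: wpb_cat; apply: wpb_save => //; apply: wpb_move_cells.
Qed.

(** The second block recomputes the far pointer in cell 14, fetches [sigma] back and clears that
    cell, since the rows kept for the letters must start at zero. The loop then computes [V] by
    adding [2k] to cell 11 [n] times. *)
Definition prepare : com :=
  Seq (Blk (save 5 ++ move_cells 24))
 (Seq (Blk [:: IConst 3 1; IConst 18 0; IAdd 13 0 18; IAdd 14 2 18;
    IAdd 13 13 14; IAdd 14 14 13; IAdd 13 13 14; IAdd 14 14 13;
    IAdd 13 13 14; IAdd 14 14 13; IAdd 13 13 14; IAdd 14 14 13;
    IAdd 13 13 14; IAdd 14 14 13; ILoad 1 14; IStore 14 18;
    IAdd 4 2 2; IConst 6 27; IAdd 6 6 0; IConst 7 51; IAdd 7 7 0; IAdd 9 7 18;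
    IConst 26 2; ISub 26 2 26; IConst 10 0; IAdd 11 9 18; IAdd 25 1 3])
 (Seq (DoWhile (Blk [:: IAdd 11 11 4; IAdd 10 10 3]) 10 0)
      (Blk [:: IConst 10 0]))).

Lemma tri_prepare n s k W h (Q : seq nat -> cells -> Prop) :
  let O := 51 + n in let V := O + (k + k) * n in
  0 < n -> 0 < k ->
  (forall j, j < n -> h (3 + j) = W j) ->
  (forall z, 3 + n <= z -> h z = 0) ->
  (forall x pd y p t q v v2 a b c d x1 y1 h',
     (forall j, j < n -> h' (addr n j) = W j) ->
     (forall z, V <= z -> h' z = 0) ->
     Q (regs n s k x (addr n 0) pd O 0 V y p t q v v2 a b c d x1 y1) h') ->
  tri prepare [:: n; s; k] h (3 * n + 121) Q.
Proof.
move=> O V n0 k0 hW h0 fin.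
have -> : 3 * n + 121 = 93 + (27 + (n * 3 + 1)) by clear; lia.
(* The coefficients of [far] are Fibonacci numbers; five rounds lead beyond [O = 51 + n] for all
   positive [n] and [k]. *)
have farE : far 5 n k = 55 * n + 89 * k by rewrite /far; clear; lia.
have farO : O < far 5 n k by rewrite farE /O; clear - n0 k0; lia.
apply: tri_seq; apply: tri_blk; first exact: isT.
apply: (@wpb_relocate 5 24 n s k h) => [|//|c1 h1 H1]; first by rewrite farE; clear - k0; lia.
apply: tri_seq; apply: (tri_view (@rd_more 27 [:: n; c1; k] h1 isT)).
lazy beta iota zeta delta [mkseq map iota rd nth].
run_block; rewrite !addn0.
let X := eval lazy beta iota delta [far] in (far 5 n k) in change X with (far 5 n k).
split; first by clear - farO; rewrite /O in farO; lia.
split; first by clear - farO; rewrite /O in farO; lia.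
have -> : h1 (far 5 n k) = s.
  by rewrite H1 /upd eqxx ifF //; clear - farO; rewrite /O in farO; lia.
rewrite addn1; set h2 := upd h1 _ 0.
rewrite -/O.
pose Inv j rs (h' : cells) := exists x pd y p t q v v2 a b c d x1 y1, h' = h2 /\
  rs = regs n s k x (addr n 0) pd O j (O + (k + k) * j) y p t q v v2 a b c d x1 y1.
apply: tri_seq; apply: (tri_for (Inv := Inv) n0).
- by do 14 eexists; split=> //; rewrite muln0 addn0 /addr addn0.
- move=> j rs h' jn [x [pd [y [p [t [q [v [w [a [b [c [d [x1 [y1 [-> ->]]]]]]]]]]]]]]].
  run_block; split; last by rewrite addn1.
  exists x, pd, y, p, t, q, v, w, a, b, c, d, x1, y1; split=> //.
  by rewrite addn1 mulnSr [O + (_ + (k + k))]addnA.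
move=> rs h' [x [pd [y [p [t [q [v [w [a [b [c [d [x1 [y1 [-> ->]]]]]]]]]]]]]]].
run_block; apply: fin => [j jn|z zV]; rewrite /h2 /upd.
  have aO := addr_lt jn.
  rewrite ifF; last by move: aO farO; rewrite /O; clear; lia.
  rewrite H1 /addr; case: (ltnP j 24) => lj.
    rewrite ifT; last by clear - lj; lia.
    rewrite /upd ifF; last by move: farO lj; rewrite /O; clear; lia.
    by rewrite -hW //; congr h; clear; lia.
  rewrite ifF; last by clear - jn; lia.
  by rewrite /upd ifF ?hW //; move: farO jn; rewrite /O; clear; lia.
case: eqP => // /eqP zf; have zO : O <= z by apply: leq_trans zV; apply: leq_addr.
rewrite H1 ifF; last by move: zO; rewrite /O; clear; lia.
by rewrite /upd (negPf zf) h0 //; move: zO; rewrite /O; clear; lia.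
Qed.

(* The output region may begin at cell 4, hence only the cells 0 to 3 are used
   as registers in the loop. *)
Definition output : com :=
  Seq (Blk [:: IConst 1 3; IAdd 1 1 0; IAdd 3 11 18; IConst 2 51; IAdd 0 2 0])
    (DoWhile (Blk [:: ILoad 2 0; IStore 1 2; IConst 2 1; IAdd 0 0 2; IAdd 1 1 2]) 0 3).

Lemma tri_output n s k x pw pd po i y p t q v v2 a b c d x1 y1 h N
    (Q : seq nat -> cells -> Prop) :
  let O := 51 + n in 0 < n -> 0 < N ->
  (forall rs h', (forall u, u < N -> rd rs h' (3 + n + u) = h (O + u)) -> Q rs h') ->
  tri output (regs n s k x pw pd po i (O + N) y p t q v v2 a b c d x1 y1) h
    (6 * N + 5) Q.
Proof.
move=> O n0 N0 fin; rewrite [6 * N + 5]addnC [6 * N]mulnC; apply: tri_seq; run_block; rewrite addn0.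
match goal with |- tri _ ?rs _ _ _ => set rs0 := rs end.
apply: (tri_view (rd_less 4 rs0 h)).
have hO u : rd rs0 h (O + u) = h (O + u) by rewrite rd_heap // /O /=; clear; lia.
move: (rd rs0 h) hO => h0 hO; rewrite {}/rs0; lazy beta iota zeta delta [take].
(* The copy goes upwards and its source is 48 cells above its target, so every cell still to be read
   is intact; the second clause records this. *)
pose Inv j rs h' := exists v,
  rs = [:: O + j; 3 + n + j; v; O + N] /\
  [/\ forall u, u < j -> h' (3 + n + u) = h (O + u)
    & forall z, 3 + n + j <= z -> h' z = h0 z].
apply: (tri_for (Inv := Inv) N0).
- by exists 51; rewrite !addn0; split.
- move=> j rs h' jN [v' [-> [H1 H2]]]; run_block.
  split; first by rewrite /O; clear; lia.
  split; first by clear - n0; lia.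
  split; last by rewrite addn1 -addnS /rd /= ltn_add2l.
  exists 1; rewrite !addn1 -!addnS; split=> //; split.
    move=> u; rewrite ltnS leq_eqVlt /upd => /orP[/eqP->|uj].
      by rewrite eqxx H2 ?hO // /O; clear; lia.
    by rewrite eqn_add2l (ltn_eqF uj) H1.
  by move=> z zq; rewrite /upd ifF ?H2 //; clear - zq; lia.
move=> rs h' [v' [-> [H1 H2]]]; apply: fin => u uN.
by rewrite rd_heap ?H1 //=; clear - n0; lia.
Qed.

(** * The complete program and its running time *)

Lemma exec_mono P t t' st fin : t <= t' ->
  exec P t st = Some fin -> exec P t' st = Some fin.
Proof.
elim: t t' st => [|t IH] t' st le /=.
  by case: ifP => // H [<-]; case: t' {le} => /= [|t']; rewrite H.
case: t' le => // t' le /=; case: ifP => // _; exact: IH.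
Qed.

Lemma exec_halt P t p m : nth IHalt P p = IHalt ->
  exec P t (State p m) = Some (State p m).
Proof. by move=> H; case: t => [|t]; rewrite /= /halted /= H. Qed.

Definition main : com := Seq prepare (Seq fill_table output).

Lemma tri_main n s k W R h (Q : seq nat -> cells -> Prop) :
  0 < n -> 0 < k -> (forall i, i < n -> 0 < W i <= s) ->
  (forall i u, i < n -> u < k + k ->
     R i u = ((u == 0) || (u == k)) + \sum_(j < i) contrib k (R j) (W j) (W i) u) ->
  (forall j, j < n -> h (3 + j) = W j) ->
  (forall z, 3 + n <= z -> h z = 0) ->
  (forall rs h', (forall i u, i < n -> u < k + k ->
      rd rs h' (3 + n + ((k + k) * i + u)) = R i u) -> Q rs h') ->
  tri main [:: n; s; k] h
    (3 * n + 121 + (n * (73 * (s * k)) + (6 * ((k + k) * n) + 5))) Q.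
Proof.
move=> n0 k0 Ws Rrec hW h0 fin.
apply: tri_seq; apply: (tri_prepare (W := W)) => // x pd y p t q v v2 a b c d x1 y1 h1 W1 Z1.
apply: tri_seq; apply: (tri_fill_table (W := W) (R := R)) => //.
move=> x' pw pd' po i y' p' t' q' v' v2' a' b' c' d' x1' y1' h2 H2.
apply: tri_output => //; first by rewrite muln_gt0 n0 addn_gt0 k0.
move=> rs h' H; apply: fin => i' u li lu; rewrite H ?addnA ?H2 //.
have : (k + k) * i'.+1 <= (k + k) * n by rewrite leq_mul2l li orbT.
by rewrite mulnSr; apply: leq_trans; rewrite ltn_add2l.
Qed.

(** The prelude halts if [n] or [k] is 0, when the table is empty. As no free cell holds a zero,
    positivity is tested by [k < n + k] and [sigma < k + sigma], and each sum is undone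
    afterwards. *)
Definition prog : program :=
  [:: IAdd 0 0 2; IJlt 2 0 3; IHalt; ISub 0 0 2;
      IAdd 2 2 1; IJlt 1 2 7; IHalt; ISub 2 2 1] ++ compile 8 main.

Lemma prog_skip m : (m 0 == 0) || (m 2 == 0) ->
  exists fin, exec prog 6 (State 0 m) = Some fin.
Proof.
move=> z; rewrite (@exec_basic _ _ _ (IAdd 0 0 2)) // (@exec_jlt _ _ _ 2 0 3) //.
case: ifP => lt; last by rewrite exec_halt //; eexists.
rewrite (@exec_basic _ _ _ (ISub 0 0 2)) // (@exec_basic _ _ _ (IAdd 2 2 1)) //.
rewrite (@exec_jlt _ _ _ 1 2 7) // ifF; first by rewrite exec_halt //; eexists.
by move: lt; rewrite /= /upd /=; clear - z; lia.
Qed.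

Lemma prog_start m : 0 < m 0 -> 0 < m 2 ->
  exists m', m' =1 m /\
    forall r, exec prog (6 + r) (State 0 m) = exec prog r (State 8 m').
Proof.
move=> n0 k0.
exists (upd (upd (upd (upd m 0 (m 0 + m 2)) 0 (m 0 + m 2 - m 2)) 2 (m 2 + m 1)) 2 (m 2 + m 1 - m 1)).
split=> [|r]; first by case=> [|[|[|z]]]; rewrite /upd //= ?addnK.
rewrite (@exec_basic _ _ _ (IAdd 0 0 2)) // (@exec_jlt _ _ _ 2 0 3) // ifT; last first.
  by rewrite /= /upd /=; clear - n0; lia.
rewrite (@exec_basic _ _ _ (ISub 0 0 2)) // (@exec_basic _ _ _ (IAdd 2 2 1)) //.
rewrite (@exec_jlt _ _ _ 1 2 7) // ifT; last by rewrite /= /upd /=; clear - k0; lia.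
rewrite (@exec_basic _ _ _ (ISub 2 2 1)) //.
Qed.

Lemma prog_correct n s k W R m :
  0 < n -> 0 < k -> (forall i, i < n -> 0 < W i <= s) ->
  (forall i u, i < n -> u < k + k ->
     R i u = ((u == 0) || (u == k)) + \sum_(j < i) contrib k (R j) (W j) (W i) u) ->
  m 0 = n -> m 1 = s -> m 2 = k ->
  (forall j, j < n -> m (3 + j) = W j) ->
  (forall z, 3 + n <= z -> m z = 0) ->
  exists fin, exec prog (200 * (n * s * k + 1)) (State 0 m) = Some fin /\
    forall i u, i < n -> u < k + k -> memory fin (3 + n + ((k + k) * i + u)) = R i u.
Proof.
move=> n0 k0 Ws Rrec m0 m1 m2 mW mz.
have [|//|m' [mE st]] := @prog_start m; rewrite ?m0 ?m2 //.
have rm' : m' =1 rd [:: n; s; k] m.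
  by move=> z; rewrite mE /rd; case: z => [|[|[|z]]] //=; rewrite nth_nil.
have [] := tri_main (R := R) (W := W) (Q := fun rs h =>
  forall i u, i < n -> u < k + k -> rd rs h (3 + n + ((k + k) * i + u)) = R i u)
  n0 k0 Ws Rrec mW mz (fun _ _ H => H) rm'.
move=> t [m1' [rs' [h' [B le E q]]]].
exists (State (8 + clen main) m1'); split; last by move=> i u li lu; rewrite /= E q.
(* Running past the last instruction halts, [IHalt] being the default of [nth]. *)
have stop : nth IHalt prog (8 + clen main) = IHalt.
  by rewrite nth_default // /prog size_cat size_compile.
have code : code_at prog 8 (compile 8 main) by move=> j _.
apply: (@exec_mono _ (6 + (t + 0))); last first.
  by rewrite st (exec_compile B _ code) exec_halt.
have s0 : 0 < s by have /andP[] := Ws 0 n0; apply: leq_trans.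
have n_le : n <= n * s * k by rewrite -mulnA leq_pmulr // muln_gt0 s0.
have nk_le : k * n <= n * s * k by rewrite mulnC leq_pmul2r // leq_pmulr.
(* The total [132 + 3 n + 73 n s k + 12 k n] is at most [132 + 88 n s k], within the factor 200. *)
move: le; rewrite mulnDl (mulnCA n) [n * (s * k)]mulnA; move: n_le nk_le; clear.
by set A := n * s * k; set B := k * n; clearbody A B; lia.
Qed.

Definition table_row (w : seq nat) (k i u : nat) : nat :=
  if u < k then rtable w k i true u.+1 else rtable w k i false (u - k).+1.

Lemma table_row_rec w k i u : i < size w -> 0 < k -> u < k + k ->
  table_row w k i u = ((u == 0) || (u == k)) +
    \sum_(j < i) contrib k (table_row w k j) (nth 0 w j) (nth 0 w i) u.
Proof.
move=> li k0 uk.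
have k1 : maxn 1 k.-1 = (k - 2).+1 by clear - k0; lia.
have lk2 : (k - 2 < k) by clear - k0; lia.
have hk v : (k + v < k) = false by clear; lia.
have m1 v : maxn 1 v = v.-1.+1 by clear; lia.
rewrite {1}/table_row; case: (ltnP u k) => lu; rewrite rtable_rec //.
  rewrite eqSS (ltn_eqF lu) orbF; congr (_ + _); apply: eq_bigr => j _.
  rewrite /contrib /table_row lu (leq_ltn_trans (leq_pred u) lu) hk addKn.
  by rewrite k1 m1.
have nu : (u < k) = false by rewrite ltnNge lu.
have u0 : (u == 0) = false by clear - k0 lu; lia.
have uE : (u - k == 0) = (u == k) by rewrite subn_eq0 eqn_leq lu andbT.
rewrite eqSS uE u0 /=; congr (_ + _); apply: eq_bigr => j _.
rewrite /contrib /table_row nu /= lk2 hk addKn k1 m1.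
by case: (ltngtP (nth 0 w j) (nth 0 w i)).
Qed.

Theorem theorem13 :
  exists (P : program) (c : nat),
    forall (sigma : nat) (w : seq nat) (k : nat),
      (forall x, (x \in w) = (1 <= x <= sigma)) ->
      exists fin : state,
        exec P (c * (size w * sigma * k + 1)) (init_state w sigma k) = Some fin /\
        forall (i : nat) (xi : bool) (h : nat),
          i < size w -> 1 <= h <= k ->
          memory fin (out_addr (size w) k i xi h) = rtable w k i xi h.
Proof.
exists prog, 200 => sigma w k letters; rewrite /init_state; set m := fun x : nat => _.
have [triv|] := boolP ((size w == 0) || (k == 0)).
  have [fin E] := @prog_skip m triv; exists fin; split.
    by apply: exec_mono E; clear; lia.
  by move=> i xi h li lh; exfalso; clear - triv li lh; lia.
rewrite negb_or -!lt0n => /andP[n0 k0].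
have [|||||j lj|z lz|fin [E M]] := @prog_correct (size w) sigma k (nth 0 w) (table_row w k) m n0 k0.
- by move=> i li; rewrite -letters mem_nth.
- by move=> i u li uk; apply: table_row_rec.
- by [].
- by [].
- by [].
- by rewrite /m ltn_add2l lj /= addKn.
- by rewrite /m; do 3 (case: z lz => // z lz); rewrite /= ltnNge lz.
exists fin; split=> // i xi h li /andP[h0 hk].
have uk : (~~ xi) * k + h.-1 < k + k by clear - h0 hk; case: xi => /=; lia.
have -> : out_addr (size w) k i xi h = 3 + size w + ((k + k) * i + ((~~ xi) * k + h.-1)).
  by rewrite /out_addr mulnDl -[_ + _ + h.-1]addnA addnn -mul2n [2 * k * i]mulnAC.
rewrite M // /table_row; case: xi {uk} => /=.
  by rewrite mul0n add0n prednK ?hk.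
by rewrite mul1n ltnNge leq_addr /= addKn prednK.
Qed.
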